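(* Let $2\le m\le n$ be integers, $\mathcal{H}=\mathbb{C}^2\otimes\mathbb{C}^m\otimes\mathbb{C}^n$ and $G=SL(2,\mathbb{C})\times SL(m,\mathbb{C})\times SL(n,\mathbb{C})$ acting by $A\otimes B\otimes C$. There exist strictly semistable states in $\mathbb{P}(\mathcal{H})$ if and only if $m=n\ge 4$.
   Context: The null-cone $\mathcal{N}$ is the set of vectors $|\psi\rangle$ with $0\in\overline{G|\psi\rangle}$ (standard topology); vectors outside $\mathcal{N}$ are semistable. A semistable vector is polystable if its orbit $G|\psi\rangle$ is closed in $\mathcal{H}$, and strictly semistable if it is semistable but not polystable. A state $[\psi]$ is strictly semistable if $|\psi\rangle$ is. *)

(* Defs.v *)
From mathcomp Require Import all_boot all_algebra.
From mathcomp Require Import complex reals.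
Set Implicit Arguments. Unset Strict Implicit. Unset Printing Implicit Defensive.
Import GRing.Theory Num.Theory.
Local Open Scope ring_scope.

Definition tensor (R : realType) (m n : nat) := 'I_2 -> 'I_m -> 'I_n -> R[i].

Definition act (R : realType) (m n : nat)
  (A : 'M[R[i]]_2) (B : 'M[R[i]]_m) (C : 'M[R[i]]_n) (psi : tensor R m n)
  : tensor R m n :=
  fun i j k => \sum_(a < 2) \sum_(b < m) \sum_(c < n)
                 A i a * B j b * C k c * psi a b c.

Definition inG (R : realType) (m n : nat)
  (A : 'M[R[i]]_2) (B : 'M[R[i]]_m) (C : 'M[R[i]]_n) : Prop :=
  \det A = 1 /\ \det B = 1 /\ \det C = 1.

(* phi lies in the closure (standard topology on C^(2mn), here via the
   sup-norm of coordinates) of the orbit G psi. *)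
Definition in_orbit_closure (R : realType) (m n : nat) (psi phi : tensor R m n) : Prop :=
  forall eps : R, 0 < eps ->
    exists (A : 'M[R[i]]_2) (B : 'M[R[i]]_m) (C : 'M[R[i]]_n), inG A B C /\
      forall (x : 'I_2) (y : 'I_m) (z : 'I_n),
        `|act A B C psi x y z - phi x y z| < (eps%:C)%C.

Definition in_orbit (R : realType) (m n : nat) (psi phi : tensor R m n) : Prop :=
  exists (A : 'M[R[i]]_2) (B : 'M[R[i]]_m) (C : 'M[R[i]]_n), inG A B C /\ act A B C psi = phi.

Definition zero_tensor (R : realType) (m n : nat) : tensor R m n := fun _ _ _ => 0.
Arguments zero_tensor : clear implicits.

Definition in_nullcone (R : realType) (m n : nat) (psi : tensor R m n) : Prop :=
  in_orbit_closure psi (zero_tensor R m n).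

Definition semistable (R : realType) (m n : nat) (psi : tensor R m n) : Prop :=
  ~ in_nullcone psi.

Definition polystable (R : realType) (m n : nat) (psi : tensor R m n) : Prop :=
  semistable psi /\
  forall phi, in_orbit_closure psi phi -> in_orbit psi phi.

Definition strictly_semistable (R : realType) (m n : nat) (psi : tensor R m n) : Prop :=
  semistable psi /\ ~ polystable psi.

(* Main.v *)
Require Import Defs.
From mathcomp Require Import all_boot all_order all_algebra perm.
From mathcomp Require Import complex reals boolp.
From mathcomp Require Import ring lra zify.
Set Implicit Arguments. Unset Strict Implicit. Unset Printing Implicit Defensive.
Import Order.TTheory GRing.Theory Num.Theory.
Local Open Scope ring_scope.

(** A tensor is a pencil of two [m x n] matrices. For [m < n], a semistable
    pencil satisfies King's inequality
    [n * dim V <= m * dim (V X0 + V X1)]; passing to the kernel of the stacked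
    matrix (castling) replaces the size [(m, n)] by [(2m - n, m)] and shows by
    induction that all such pencils are [GL_m x GL_n]-equivalent. A
    Sylvester-type determinant of order [k (n - m) (k + 1)], where
    [m = k (n - m)], is an invariant which pins down the remaining scalars, so
    semistable orbits are closed.

    For [m = n <= 3], semistability forces the binary form [det (x X0 + y X1)]
    to have simple roots; the pencil is then diagonalizable and equivalent to a
    multiple of one fixed tensor, and the discriminant determines the multiple
    up to a root of unity realized inside [G].

    For [m = n >= 4], a bidiagonal pencil whose determinant has a double root
    but no root of multiplicity above [n / 2] is semistable and degenerates to
    a pencil with a member of rank at most [n - 2], while all its own nonzero
    members have rank at least [n - 1]. *)

(** * Castling of King-semistable pencils *)

(** Closedness always follows one pattern. A semistable tensor and a limit of its orbit, which is
    semistable too, are equivalent under general linear groups. A continuous G-invariant, nonzero on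
    both, constrains the scalars relating them, and explicit stabilizers or elements of G absorb
    what remains. Of the Hilbert-Mumford criterion only the easy half is used: a one-parameter
    subgroup with positive weights on the support sends the tensor to zero. Semistability of the
    square witness, which would call for the hard half, comes from a lower bound on its determinant
    form that is uniform over SL_2.

    The threshold 4 enters twice: a double zero is destabilized through a weight 7 - 2n, positive
    only for n at most 3, and a root of multiplicity 2 respects the bound n / 2 only from n = 4 on.
    The superdiagonal of the witness carries x - y because, on the projective line, this form
    vanishes only where the determinant does not; so every member keeps corank at most one. *)

Section Castling.
Variable F : fieldType.

Definition king_semistable m n (X0 X1 : 'M[F]_(m, n)) : Prop :=
  forall p (V : 'M[F]_(p, m)),
    (n * \rank V <= m * \rank (V *m X0 + V *m X1)%MS)%N.

(** Since [P] has full column rank, its left kernel has rank [q - n = p], so the independent rows of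
    [K] span it. *)
Lemma exact_sub p q n r (K : 'M[F]_(p, q)) (P : 'M[F]_(q, n)) (Z : 'M[F]_(r, q)) :
  (p + n = q)%N -> row_free K -> row_full P -> K *m P = 0 -> Z *m P = 0 ->
  (Z <= K)%MS.
Proof.
move=> e fK fP KP ZP.
have sK : (K <= kermx P)%MS by apply/sub_kermxP.
have sZ : (Z <= kermx P)%MS by apply/sub_kermxP.
apply: (submx_trans sZ); rewrite -(mxrank_leqif_sup sK) mxrank_ker.
by rewrite (eqP fK) (eqP fP); apply/eqP; lia.
Qed.

(** A matrix of full column rank is determined by its left kernel up to an invertible column
    operation, and [invmx D *m P] and [P'] share the left kernel spanned by [K']. This lifts an
    equivalence of castled pencils back to the original ones. *)
Lemma exact_quotient p q n (K K' : 'M[F]_(p, q)) (P P' : 'M[F]_(q, n))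
    (b : 'M[F]_p) (D : 'M[F]_q) :
  (p + n = q)%N -> row_free K' -> row_full P -> row_full P' ->
  K *m P = 0 -> K' *m P' = 0 -> b \in unitmx -> D \in unitmx ->
  b *m K *m D = K' ->
  exists2 C : 'M[F]_n, C \in unitmx & P' = invmx D *m P *m C.
Proof.
move=> e fK' fP fP' KP KP' ub uD eK.
pose A := invmx D *m P.
have fA : row_full A.
  by rewrite -col_leq_rank /A eqmxMfull ?(eqP fP) // row_full_unit unitmx_inv.
have eP' : P' = A *m (pinvmx A *m P').
  apply/eqP; rewrite -subr_eq0 mulmxA -{1}[P']mul1mx -mulmxBl; apply/eqP.
  have /submxP[w ->] : (1%:M - A *m pinvmx A <= K')%MS.
    apply: (exact_sub e fK' fA).
      by rewrite -eK /A !mulmxA mulmxK // -mulmxA KP mulmx0.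
    by rewrite mulmxBl mul1mx -mulmxA mulVpmx // mulmx1 subrr.
  by rewrite -mulmxA KP' mulmx0.
exists (pinvmx A *m P') => //.
rewrite -row_full_unit -col_leq_rank.
by move: (fP'); rewrite -col_leq_rank => /leq_trans-> //; rewrite {1}eP' mxrankM_maxr.
Qed.

Lemma king_full m n (X0 X1 : 'M[F]_(m, n)) :
  (0 < m)%N -> king_semistable X0 X1 -> row_full (col_mx X0 X1).
Proof.
move=> m0 /(_ m 1%:M); rewrite !mul1mx mxrank1 mulnC leq_pmul2l // => h.
by rewrite -col_leq_rank (leq_trans h) // addsmxE.
Qed.

(** With [W] spanned by [U] times both halves of [K], the rows of [U *m K] lie in the part of the
    direct sum of two copies of [W] killed by the stacked matrix. Its dimension is [2 rank W] minus
    the rank of [W X0 + W X1], so King's inequality for [W] gives the one for [U]. The sign and the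
    order of the halves turn chains [v j *m X1 + v j.+1 *m X0 = 0] into chains of the same kind, one
    step shorter. *)
Lemma castling m n p (X0 X1 : 'M[F]_(m, n)) :
  (0 < m)%N -> (p + n = m + m)%N -> king_semistable X0 X1 ->
  exists K : 'M[F]_(p, m + m),
    [/\ row_free K, K *m col_mx X0 X1 = 0 &
        king_semistable (- rsubmx K) (lsubmx K)].
Proof.
move=> m0 e sX; set P := col_mx X0 X1.
have fP : row_full P by apply: king_full.
have eK : \rank (kermx P) = p by rewrite mxrank_ker (eqP fP); lia.
have [K fK KP] : exists2 K : 'M[F]_(p, m + m), row_free K & K *m P = 0.
  case: _ / eK {e}; exists (row_base (kermx P)); first exact: row_base_free.
  by apply/sub_kermxP; rewrite eq_row_base.
exists K; split=> // r U.
set W := (_ + _)%MS.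
have hl : (U *m lsubmx K <= W)%MS by apply: addsmxSr.
have hr : (U *m rsubmx K <= W)%MS.
  by rewrite -[U *m rsubmx K]opprK eqmx_opp -mulmxN addsmxSl.
have hX := sX _ W.
pose D := block_mx W 0 0 W.
have DP : D *m P = col_mx (W *m X0) (W *m X1).
  by rewrite /D /P mul_block_col !mul0mx addr0 add0r.
have rD : \rank D = (\rank W + \rank W)%N by rewrite rank_diag_block_mx.
have UK : (U *m K <= D :&: kermx P)%MS.
  rewrite sub_capmx; apply/andP; split; last first.
    by apply/sub_kermxP; rewrite -mulmxA KP mulmx0.
  have [a ea] := submxP hl; have [b eb] := submxP hr.
  apply/submxP; exists (row_mx a b).
  by rewrite /D mul_row_block !mulmx0 addr0 add0r -ea -eb -mul_mx_row hsubmxK.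
have := mxrankS UK; rewrite mxrankMfree // => h1.
have := mxrank_mul_ker D P; rewrite rD DP -addsmxE => h2.
have: (n * \rank W + m * \rank U <= (p + n) * \rank W)%N by rewrite e; nia.
nia.
Qed.

Lemma king_equiv m n (X0 X1 Y0 Y1 : 'M[F]_(m, n)) :
  (m < n)%N -> king_semistable X0 X1 -> king_semistable Y0 Y1 ->
  exists B C, [/\ B \in unitmx, C \in unitmx,
    B *m X0 *m C = Y0 & B *m X1 *m C = Y1].
Proof.
have [k] := ubnP m; elim: k m n X0 X1 Y0 Y1 => // k IH m n X0 X1 Y0 Y1 lmk lmn sX sY.
have [m0 | m0] := posnP m.
  subst m; exists 1%:M, 1%:M; rewrite !unitmx1.
  by split=> //; apply/matrixP=> [[]].
have fX := king_full m0 sX; have fY := king_full m0 sY.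
have n2m : (n <= m + m)%N by rewrite -(eqP fX) rank_leq_row.
have e : ((m + m - n) + n = m + m)%N by rewrite subnK.
have [K [fK KX sK]] := castling m0 e sX.
have [L [fL LY sL]] := castling m0 e sY.
have [|| b [c [ub uc e0 e1]]] := IH _ _ _ _ _ _ _ _ sK sL; [lia|lia|].
have uD : block_mx c 0 0 c \in unitmx by rewrite unitmxE det_ublock unitrM -!unitmxE uc.
have eL : b *m K *m block_mx c 0 0 c = L.
  rewrite -[K]hsubmxK -[L]hsubmxK mul_mx_row mul_row_block !mulmx0 addr0 add0r e1.
  by congr row_mx; apply: oppr_inj; rewrite -e0 mulmxN mulNmx.
have [C uC eC] := exact_quotient e fL fX fY KX LY ub uD eL.
have uc' : invmx c \in unitmx by rewrite unitmx_inv.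
(* The columns of both halves of [K] pair with the rows of [X0] and [X1], so the castled column
   change [c] acts on those rows by its inverse. *)
exists (invmx c), C.
have eI : invmx (block_mx c 0 0 c) = block_mx (invmx c) 0 0 (invmx c).
  apply: (can_inj (mulKmx uD)); rewrite mulmxV // mulmx_block !mulmx0 !mul0mx.
  by rewrite mulmxV // !addr0 !add0r -scalar_mx_block.
move: eC; rewrite eI mul_block_col !mul0mx addr0 add0r mul_col_mx => /eq_col_mx[-> ->].
by split.
Qed.

End Castling.

(** * The Sylvester determinant of a pencil *)

Section Resultant.
Variable F : fieldType.

(** [K] and [P] form a short exact sequence respected by [b], [D] and [C]. Completing the rows of
    [K] by a left inverse [Q] of [P] makes [D] block triangular with diagonal blocks [b] and [C]. *)
Lemma det_exact p q n (K : 'M[F]_(p, q)) (P : 'M[F]_(q, n))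
    (b : 'M[F]_p) (D : 'M[F]_q) (C : 'M[F]_n) :
  (p + n = q)%N -> row_free K -> row_full P -> K *m P = 0 ->
  K *m D = b *m K -> D *m P = P *m C -> \det D = \det b * \det C.
Proof.
move=> e; subst q => fK fP KP KD DP.
have [Q QP] : exists Q, Q *m P = 1%:M by exists (pinvmx P); apply: mulVpmx.
have /submxP[Z eZ] : (Q *m D - C *m Q <= K)%MS.
  apply: (exact_sub (erefl _) fK fP KP).
  by rewrite mulmxBl -!mulmxA DP QP mulmx1 mulmxA QP mul1mx subrr.
pose G := col_mx K Q.
have uG : G \in unitmx.
  have : \det (G *m row_mx (pinvmx K) P) = 1.
    by rewrite mul_col_row KP QP mulmxVp // det_lblock !det1 mulr1.
  rewrite det_mulmx unitmxE unitfE => h.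
  by apply/eqP=> h0; move: h; rewrite h0 mul0r => /esym/eqP; rewrite oner_eq0.
have GD : G *m D = block_mx b 0 Z C *m G.
  rewrite mul_col_mx mul_block_col mul0mx addr0 KD -eZ.
  by rewrite subrK.
have := congr1 determinant GD; rewrite !det_mulmx det_lblock mulrC.
by apply: mulIf; rewrite -unitfE -unitmxE.
Qed.

(** The three properties share one induction, as castling keeps [n - m] and lowers [k] by one. The
    stabilizers serve to correct determinants without leaving the pencil; the statement on chains
    says that the Sylvester matrix has no left kernel. *)
Lemma king_structure m n (X0 X1 : 'M[F]_(m, n)) :
  (m < n)%N -> king_semistable X0 X1 ->
  exists k, [/\ (m = k * (n - m))%N,
    forall h : F, h != 0 -> exists b c,
      [/\ b *m X0 *m c = X0, b *m X1 *m c = X1,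
          \det b = h ^- k & \det c = h ^+ k.+1] &
    forall v : nat -> 'rV[F]_m,
      (forall j, (j < k)%N -> v j *m X1 + v j.+1 *m X0 = 0) ->
      forall j, (j <= k)%N -> v j = 0].
Proof.
have [N] := ubnP m; elim: N m n X0 X1 => // N IH m n X0 X1 lmN lmn sX.
have [m0 | m0] := posnP m.
  subst m; exists 0%N; split=> // [h h0|v _ j _]; last by apply/matrixP=> ? [].
  case: n lmn X0 X1 {sX} => // n _ X0 X1.
  exists 1%:M, (diag_mx (\row_j (if j == ord0 then h else 1))).
  split; try by apply/matrixP=> [[]].
    by rewrite det1 expr0 invr1.
  rewrite det_diag big_ord_recl mxE eqxx big1 ?mulr1 ?expr1 // => i _.
  by rewrite mxE.
have fX := king_full m0 sX.
have n2m : (n <= m + m)%N by rewrite -(eqP fX) rank_leq_row.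
have e : ((m + m - n) + n = m + m)%N by rewrite subnK.
have [K [fK KX sK]] := castling m0 e sX.
have [|| k [ek stab inj]] := IH _ _ _ _ _ _ sK; [lia|lia|].
have ed : (m - (m + m - n) = n - m)%N by lia.
rewrite ed in ek.
exists k.+1; split; first by rewrite mulSn; lia.
  move=> h h0; have [b [c [e0 e1 db dc]]] := stab h h0.
  have uc : c \in unitmx by rewrite unitmxE dc unitfE expf_neq0.
  have ub : b \in unitmx by rewrite unitmxE db unitfE invr_eq0 expf_neq0.
  have uD : block_mx c 0 0 c \in unitmx by rewrite unitmxE det_ublock unitrM -!unitmxE uc.
  have eK : b *m K *m block_mx c 0 0 c = K.
    rewrite -[K]hsubmxK mul_mx_row mul_row_block !mulmx0 addr0 add0r e1.
    by congr row_mx; apply: oppr_inj; rewrite -[RHS]e0 mulmxN mulNmx.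
  have [C uC eC] := exact_quotient e fK fX fX KX KX ub uD eK.
  have DP : block_mx c 0 0 c *m col_mx X0 X1 = col_mx X0 X1 *m C.
    by rewrite {1}eC !mulmxA mulmxV // mul1mx.
  have KD : K *m block_mx c 0 0 c = invmx b *m K.
    by rewrite -[in RHS]eK !mulmxA mulVmx // mul1mx.
  (* Here [k] is the castled value: the exact sequence gives [\det C = \det b * \det c ^+ 2], which
     is [h ^+ (k + 2)]. *)
  have := det_exact e fK fX KX KD DP.
  rewrite det_ublock det_inv db dc invrK => eD.
  move: DP; rewrite mul_block_col !mul0mx addr0 add0r mul_col_mx => /eq_col_mx[d0 d1].
  exists (invmx c), C; split.
  - by rewrite -mulmxA -d0 mulmxA mulVmx // mul1mx.
  - by rewrite -mulmxA -d1 mulmxA mulVmx // mul1mx.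
  - by rewrite det_inv dc.
  have hk : h ^+ k != 0 by rewrite expf_neq0.
  by apply: (mulfI hk); rewrite -eD -!exprD; congr (_ ^+ _); lia.
move=> v hv.
(* The chain relation puts [(v j.+1, v j)] in the left kernel of the stacked matrix, which is the
   row space of [K]; [w j] is its coordinate vector there. *)
pose w j := row_mx (v j.+1) (v j) *m pinvmx K.
have ew j : (j <= k)%N -> w j *m K = row_mx (v j.+1) (v j).
  move=> jk; rewrite mulmxKpV //; apply: (exact_sub e fK fX KX).
  by rewrite mul_row_col addrC hv.
have el j : (j <= k)%N -> w j *m lsubmx K = v j.+1.
  by move=> jk; rewrite -[v j.+1](row_mxKl _ (v j)) -ew // -[K in RHS]hsubmxK mul_mx_row row_mxKl.
have er j : (j <= k)%N -> w j *m rsubmx K = v j.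
  by move=> jk; rewrite -[RHS](row_mxKr (v j.+1)) -ew // -[K in RHS]hsubmxK mul_mx_row row_mxKr.
have w0 j : (j <= k)%N -> w j = 0.
  by apply: inj => i ik; rewrite mulmxN el ?er ?subrr // ltnW.
case=> [|j] jk; first by rewrite -er // w0 // mul0mx.
by rewrite -el // w0 // mul0mx.
Qed.

(** This is multiplication by [X1 + t X0] from polynomial column vectors of degree below [k] to
    those of degree at most [k]. It is square exactly when [m = k (n - m)]. *)
Fixpoint sylvester m n k (X0 X1 : 'M[F]_(m, n)) : 'M[F]_(k.+1 * m, k * n) :=
  match k with
  | 0 => 0
  | k'.+1 => block_mx X1 0 (col_mx X0 0) (sylvester k' X0 X1)
  end.

Fixpoint diag_copies m k (B : 'M[F]_m) : 'M[F]_(k * m) :=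
  match k with
  | 0 => 1%:M
  | k'.+1 => block_mx B 0 0 (diag_copies k' B)
  end.

Lemma det_diag_copies m k (B : 'M[F]_m) : \det (diag_copies k B) = \det B ^+ k.
Proof. by elim: k => [|k IH] /=; rewrite ?det1 ?det_ublock ?IH ?exprS. Qed.

Lemma sylvesterM m n k (X0 X1 : 'M[F]_(m, n)) B C :
  sylvester k (B *m X0 *m C) (B *m X1 *m C)
  = diag_copies k.+1 B *m sylvester k X0 X1 *m diag_copies k C.
Proof.
elim: k => [|k IH]; first by rewrite /= mulmx0 mul0mx.
rewrite [sylvester k.+1 _ _]/= IH [diag_copies k.+2 _]/=.
rewrite [sylvester k.+1 X0 X1]/= [diag_copies k.+1 C]/= !mulmx_block.
rewrite !(mulmx0, mul0mx, addr0, add0r); congr block_mx.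
by rewrite mul_block_col !(mulmx0, mul0mx, addr0, add0r) mul_col_mx mul0mx.
Qed.

Fixpoint row_block m k : 'rV[F]_(k * m) -> nat -> 'rV[F]_m :=
  match k with
  | 0 => fun _ _ => 0
  | k'.+1 => fun x j => if j is j'.+1 then row_block (rsubmx x) j'
                        else lsubmx x
  end.

Lemma row_block_eq0 m k (x : 'rV[F]_(k * m)) :
  (forall j, (j < k)%N -> row_block x j = 0) -> x = 0.
Proof.
elim: k x => [|k IH] x h; first by apply/matrixP=> ? [].
rewrite -[x]hsubmxK; have -> : lsubmx x = 0 by exact: (h 0%N).
by rewrite [rsubmx x]IH ?row_mx0 // => j jk; exact: (h j.+1).
Qed.

Lemma sylvester_row m n k (X0 X1 : 'M[F]_(m, n)) (x : 'rV[F]_(k.+1 * m)) :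
  x *m sylvester k X0 X1 = 0 ->
  forall j, (j < k)%N -> row_block x j *m X1 + row_block x j.+1 *m X0 = 0.
Proof.
elim: k x => // k IH x.
rewrite -[x in x *m _]hsubmxK [sylvester _ _ _]/= mul_row_block => h.
have := h; rewrite -[RHS]row_mx0 => /eq_row_mx[h0 h1].
case=> [|j] jk.
  by rewrite -[rsubmx x]hsubmxK mul_row_col mulmx0 addr0 in h0.
by apply: IH => //; rewrite mulmx0 add0r in h1.
Qed.

Definition hyperdet m n k (e : (k.+1 * m = k * n)%N) (X0 X1 : 'M[F]_(m, n)) : F :=
  \det (castmx (e, erefl) (sylvester k X0 X1)).

Lemma det_castM a b (e : a = b) (L : 'M[F]_a) (S : 'M[F]_(a, b)) (T : 'M[F]_b) :
  \det (castmx (e, erefl) (L *m S *m T)) = \det L * \det (castmx (e, erefl) S) * \det T.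
Proof. by case: b / e S T => S T; rewrite !castmx_id !det_mulmx. Qed.

Lemma det_cast_neq0 a b (e : a = b) (S : 'M[F]_(a, b)) :
  (forall x : 'rV_a, x *m S = 0 -> x = 0) -> \det (castmx (e, erefl) S) != 0.
Proof.
case: b / e S => S h; rewrite castmx_id; apply/det0P => -[x x0 /h xS].
by rewrite xS eqxx in x0.
Qed.

Lemma hyperdetM m n k (e : (k.+1 * m = k * n)%N) (X0 X1 : 'M[F]_(m, n)) B C :
  hyperdet e (B *m X0 *m C) (B *m X1 *m C)
  = \det B ^+ k.+1 * hyperdet e X0 X1 * \det C ^+ k.
Proof. by rewrite /hyperdet sylvesterM det_castM !det_diag_copies. Qed.

Lemma hyperdet_neq0 m n k (e : (k.+1 * m = k * n)%N) (X0 X1 : 'M[F]_(m, n)) :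
  (forall v : nat -> 'rV[F]_m,
      (forall j, (j < k)%N -> v j *m X1 + v j.+1 *m X0 = 0) ->
      forall j, (j <= k)%N -> v j = 0) ->
  hyperdet e X0 X1 != 0.
Proof.
move=> inj; apply: det_cast_neq0 => x /sylvester_row h.
by apply: row_block_eq0 => j; apply: inj.
Qed.

End Resultant.

(** * Orbit closures and one-parameter subgroups *)

Section Tensors.
Variables (R : realType) (m n : nat).
Implicit Types (psi phi : tensor R m n).

Definition slice psi (a : 'I_2) : 'M[R[i]]_(m, n) := \matrix_(j, k) psi a j k.

Lemma slice_act A B C psi i :
  slice (act A B C psi) i = \sum_a A i a *: (B *m slice psi a *m C^T).
Proof.
apply/matrixP=> j k; rewrite mxE summxE; apply: eq_bigr => a _.
rewrite !mxE mulr_sumr exchange_big /=; apply: eq_bigr => c _.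
by rewrite !mxE mulr_suml mulr_sumr; apply: eq_bigr => b _; rewrite !mxE; ring.
Qed.

Lemma slice_inj psi phi : (forall i, slice psi i = slice phi i) -> psi = phi.
Proof.
move=> h; apply/funext=> i; apply/funext=> j; apply/funext=> k.
by have /matrixP/(_ j k) := h i; rewrite !mxE.
Qed.

Lemma actM A B C A' B' C' psi :
  act A B C (act A' B' C' psi) = act (A *m A') (B *m B') (C *m C') psi.
Proof.
apply: slice_inj => i; rewrite !slice_act.
under eq_bigr do rewrite slice_act mulmx_sumr mulmx_suml scaler_sumr.
rewrite exchange_big; apply: eq_bigr => b _ /=.
rewrite mxE scaler_suml; apply: eq_bigr => a _.
by rewrite -scalemxAr -scalemxAl scalerA trmx_mul !mulmxA.
Qed.

Lemma act1 psi : act 1%:M 1%:M 1%:M psi = psi.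
Proof.
apply: slice_inj => i; rewrite slice_act (bigD1 i) //= big1 => [|a ai].
  by rewrite mxE eqxx scale1r trmx1 mul1mx mulmx1 addr0.
by rewrite mxE eq_sym (negPf ai) scale0r.
Qed.

Lemma act_diag (a : 'rV_2) (b : 'rV_m) (c : 'rV_n) psi i j k :
  act (diag_mx a) (diag_mx b) (diag_mx c) psi i j k
  = a 0 i * b 0 j * c 0 k * psi i j k.
Proof.
rewrite /act (bigD1 i) //= [X in _ + X]big1 ?addr0 => [|i' ne]; last first.
  by do 2!(apply: big1 => ? _); rewrite mxE eq_sym (negPf ne) mulr0n !mul0r.
rewrite (bigD1 j) //= [X in _ + X]big1 ?addr0 => [|j' ne]; last first.
  by apply: big1 => ? _; rewrite [diag_mx b _ _]mxE eq_sym (negPf ne) mulr0n mulr0 !mul0r.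
rewrite (bigD1 k) //= [X in _ + X]big1 ?addr0 => [|k' ne]; last first.
  by rewrite [diag_mx c _ _]mxE eq_sym (negPf ne) mulr0n mulr0 !mul0r.
by rewrite !mxE !eqxx !mulr1n.
Qed.

Definition close (e : R[i]) psi phi := forall x y z, `|psi x y z - phi x y z| < e.

Lemma pos_complexE (e : R[i]) : 0 < e -> e = ((complex.Re e)%:C)%C /\ 0 < complex.Re e.
Proof.
case: e => a b; rewrite ltcE /= => /andP[/eqP-> h]; split=> //.
Qed.

(** A positive element of [R[i]] is real, so the radius may be taken in [R[i]] and the estimates
    stay in one type. *)
Lemma closureP psi phi :
  in_orbit_closure psi phi <->
  forall e : R[i], 0 < e -> exists A B C, inG A B C /\ close e (act A B C psi) phi.
Proof.
split=> h e e0; last by apply: (h (e%:C)%C); rewrite ltcR.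
by have [-> /h] := pos_complexE e0.
Qed.

Definition cont (f : tensor R m n -> R[i]) := forall phi (e : R[i]), 0 < e ->
  exists2 d : R[i], 0 < d & forall psi, close d psi phi -> `|f psi - f phi| < e.

Lemma closeW d d' psi phi : d <= d' -> close d psi phi -> close d' psi phi.
Proof. by move=> dd h x y z; apply: lt_le_trans (h x y z) dd. Qed.

(** Half the harmonic mean of [d] and [d'] lies below both; it replaces a minimum, since [R[i]] is
    only partially ordered. *)
Lemma common_radius (d d' : R[i]) : 0 < d -> 0 < d' ->
  exists e, [/\ 0 < e, e <= d & e <= d'].
Proof.
move=> d0 d'0; have s0 : 0 < d + d' by apply: addr_gt0.
exists (d * d' / (d + d')); split; first by rewrite divr_gt0 ?mulr_gt0.
  by rewrite ler_pdivrMr // ler_pM2l // lerDr ltW.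
by rewrite ler_pdivrMr // mulrC ler_pM2l // lerDl ltW.
Qed.

Lemma cont_const c : cont (fun=> c).
Proof. by move=> phi e e0; exists 1 => // psi _; rewrite subrr normr0. Qed.

Lemma cont_coord x y z : cont (fun psi => psi x y z).
Proof. by move=> phi e e0; exists e => // psi. Qed.

Lemma contD f g : cont f -> cont g -> cont (fun psi => f psi + g psi).
Proof.
move=> cf cg phi e e0; have e2 : 0 < e / 2 by rewrite divr_gt0.
have [d d0 hf] := cf phi _ e2; have [d' d'0 hg] := cg phi _ e2.
have [c [c0 cd cd']] := common_radius d0 d'0.
exists c => // psi h; rewrite opprD addrACA (le_lt_trans (ler_normD _ _)) //.
rewrite [e]splitr; apply: ltrD; first exact/hf/(closeW cd).
exact/hg/(closeW cd').
Qed.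

Lemma contM f g : cont f -> cont g -> cont (fun psi => f psi * g psi).
Proof.
move=> cf cg phi e e0.
pose s := `|f phi| + `|g phi| + 1.
have s0 : 0 < s by rewrite ltr_wpDl // addr_ge0.
have se0 : 0 < s + e by rewrite addr_gt0.
(* As [e' < 1], the product of the two errors is at most [e'], accounted for by the summand 1 of
   [s]; the whole error is then at most [e' * s < e]. *)
pose e' := e / (s + e).
have e'0 : 0 < e' by rewrite divr_gt0.
have e'1 : e' < 1 by rewrite ltr_pdivrMr // mul1r ltrDr.
have e's : e' * s < e by rewrite mulrAC ltr_pdivrMr // ltr_pM2l // ltrDl.
have [d d0 hf] := cf phi _ e'0; have [d' d'0 hg] := cg phi _ e'0.
have [c [c0 cd cd']] := common_radius d0 d'0.
exists c => // psi h.
have {}hf := hf _ (closeW cd h); have {}hg := hg _ (closeW cd' h).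
have -> : f psi * g psi - f phi * g phi = f phi * (g psi - g phi)
    + (f psi - f phi) * g phi + (f psi - f phi) * (g psi - g phi) by ring.
apply: le_lt_trans e's; rewrite (le_trans (ler_normD _ _)) //.
rewrite /s [leRHS]mulrDr [X in _ <= X + _]mulrDr mulr1 lerD //.
  rewrite (le_trans (ler_normD _ _)) // !normrM lerD //.
    by rewrite [leLHS]mulrC ler_wpM2r // ltW.
  by rewrite ler_wpM2r // ltW.
rewrite normrM -[leRHS]mulr1; apply: ler_pM => //; first exact: ltW.
exact: ltW (lt_trans hg e'1).
Qed.

Lemma cont_sum (I : Type) (r : seq I) (P : pred I) (f : I -> tensor R m n -> R[i]) :
  (forall i, cont (f i)) -> cont (fun psi => \sum_(i <- r | P i) f i psi).
Proof.
move=> cf; elim: r => [|i r IH].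
  by under eq_fun do rewrite big_nil; apply: cont_const.
under eq_fun do rewrite big_cons.
by case: (P i) => //; apply: contD.
Qed.

Lemma cont_prod (I : Type) (r : seq I) (P : pred I) (f : I -> tensor R m n -> R[i]) :
  (forall i, cont (f i)) -> cont (fun psi => \prod_(i <- r | P i) f i psi).
Proof.
move=> cf; elim: r => [|i r IH].
  by under eq_fun do rewrite big_nil; apply: cont_const.
under eq_fun do rewrite big_cons.
by case: (P i) => //; apply: contM.
Qed.

Definition cont_mx a b (M : tensor R m n -> 'M[R[i]]_(a, b)) :=
  forall i j, cont (fun psi => M psi i j).

Lemma cont_det a (M : tensor R m n -> 'M[R[i]]_a) :
  cont_mx M -> cont (fun psi => \det (M psi)).
Proof.
move=> cM; apply: cont_sum => s; apply: contM; first exact: cont_const.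
by apply: cont_prod => i; apply: cM.
Qed.

Lemma cont_slice a : cont_mx (slice ^~ a).
Proof. by move=> i j; under eq_fun do rewrite mxE; apply: cont_coord. Qed.

Lemma cont_mxD a b (M N : tensor R m n -> 'M[R[i]]_(a, b)) :
  cont_mx M -> cont_mx N -> cont_mx (fun psi => M psi + N psi).
Proof. by move=> cM cN i j; under eq_fun do rewrite mxE; apply: contD. Qed.

Lemma cont_mxZ a b c (M : tensor R m n -> 'M[R[i]]_(a, b)) :
  cont_mx M -> cont_mx (fun psi => c *: M psi).
Proof.
move=> cM i j; under eq_fun do rewrite mxE.
by apply: contM => //; apply: cont_const.
Qed.

Lemma cont_act A B C x y z : cont (fun psi => act A B C psi x y z).
Proof.
do 3!(apply: cont_sum => ?); apply: contM; first exact: cont_const.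
exact: cont_coord.
Qed.

Lemma cont_common (I : Type) (r : seq I) (f : I -> tensor R m n -> R[i]) phi (e : R[i]) :
  (forall i, cont (f i)) -> 0 < e ->
  exists2 d : R[i], 0 < d &
    forall psi, close d psi phi -> all (fun i => `|f i psi - f i phi| < e) r.
Proof.
move=> cf e0; elim: r => [|i r [d d0 IH]]; first by exists 1.
have [d' d'0 h] := cf i phi e e0.
have [c [c0 cd cd']] := common_radius d0 d'0.
exists c => // psi hc /=; rewrite h ?IH //; first exact: closeW hc.
exact: closeW hc.
Qed.

Lemma act_cont A B C phi (e : R[i]) : 0 < e ->
  exists2 d : R[i], 0 < d & forall psi, close d psi phi ->
    close e (act A B C psi) (act A B C phi).
Proof.
move=> e0.
pose f (t : 'I_2 * 'I_m * 'I_n) psi := act A B C psi t.1.1 t.1.2 t.2.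
have cf t : cont (f t) by apply: cont_act.
have [d d0 h] := cont_common (enum [set: 'I_2 * 'I_m * 'I_n]) phi cf e0.
exists d => // psi /h /allP hd x y z.
by apply: (hd (x, y, z)); rewrite mem_enum inE.
Qed.

Lemma invariant_closure f psi phi : cont f ->
  (forall A B C, inG A B C -> f (act A B C psi) = f psi) ->
  in_orbit_closure psi phi -> f phi = f psi.
Proof.
move=> cf invf /closureP h; apply/eqP/negPn/negP=> ne.
have e0 : 0 < `|f psi - f phi| by rewrite normr_gt0 subr_eq0 eq_sym.
have [d d0 hd] := cf phi _ e0.
have [A [B [C [gG /hd]]]] := h d d0.
by rewrite invf // ltxx.
Qed.

Lemma act0 A B C : act A B C (zero_tensor R m n) = zero_tensor R m n.
Proof.
apply/funext=> i; apply/funext=> j; apply/funext=> k.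
by do 3!(apply: big1 => ? _); rewrite mulr0.
Qed.

Lemma inGM A B C A' B' C' : inG A B C -> inG A' B' C' ->
  @inG R m n (A *m A') (B *m B') (C *m C').
Proof.
by move=> [a [b c]] [a' [b' c']]; rewrite /inG !det_mulmx a b c a' b' c' !mulr1.
Qed.

(** SL is normal in GL: conjugating by [A], [B], [C] the elements of [G] that shrink the transformed
    tensor gives elements of [G] that shrink [psi]. *)
Lemma nullcone_gl A B C psi : A \in unitmx -> B \in unitmx -> C \in unitmx ->
  in_nullcone (act A B C psi) -> in_nullcone psi.
Proof.
move=> uA uB uC /closureP h; apply/closureP => e e0.
have [d d0 hd] := act_cont (invmx A) (invmx B) (invmx C) (zero_tensor R m n) e0.
have [A' [B' [C' [[a [b c]]]]]] := h d d0.
rewrite actM => /hd; rewrite actM act0 => hc.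
exists (invmx A *m (A' *m A)), (invmx B *m (B' *m B)), (invmx C *m (C' *m C)).
split=> //; rewrite /inG !det_mulmx a b c !det_inv !mul1r.
by rewrite !mulVr // -unitmxE.
Qed.

Lemma nullcone_closure psi phi :
  in_orbit_closure psi phi -> in_nullcone phi -> in_nullcone psi.
Proof.
move=> /closureP h /closureP h0; apply/closureP => e e0.
have e2 : 0 < e / 2 by rewrite divr_gt0.
have [A [B [C [gG hg]]]] := h0 _ e2.
have [d d0 hd] := act_cont A B C phi e2.
have [A' [B' [C' [gG' /hd hg']]]] := h _ d0.
exists (A *m A'), (B *m B'), (C *m C'); split; first exact: inGM.
move=> x y z; rewrite -actM -(subrK (act A B C phi x y z) (act A B C _ x y z)) -addrA.
by rewrite (le_lt_trans (ler_normD _ _)) // [e]splitr; apply: ltrD; [apply: hg'|apply: hg].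
Qed.

(** The diagonal matrices with entries [t ^ p i], [t ^ q j], [t ^ r k] lie in [G] as the weights sum
    to zero, and they multiply each nonzero entry by a positive power of [t]. *)
Lemma weights_nullcone (p : 'I_2 -> int) (q : 'I_m -> int) (r : 'I_n -> int) psi :
  \sum_i p i = 0 -> \sum_i q i = 0 -> \sum_i r i = 0 ->
  (forall i j k, psi i j k != 0 -> 0 < p i + q j + r k) -> in_nullcone psi.
Proof.
move=> p0 q0 r0 hw; apply/closureP => e e0.
pose M := \sum_i \sum_j \sum_k `|psi i j k|.
have M0 : 0 <= M by do 3!(apply: sumr_ge0 => ? _).
have hM i j k : `|psi i j k| <= M.
  rewrite /M (bigD1 i) //= (bigD1 j) //= (bigD1 k) //= -!addrA lerDl.
  by rewrite !addr_ge0 //; do ?(apply: sumr_ge0 => ? _).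
pose t := e / (1 + M + e).
have s0 : 0 < 1 + M + e by rewrite addr_gt0 // ltr_pwDl.
have t0 : 0 < t by rewrite divr_gt0.
have t1 : t <= 1 by rewrite ler_pdivrMr // mul1r lerDr addr_ge0.
have tM : t * M < e.
  by rewrite mulrAC ltr_pdivrMr // ltr_pM2l // -addrA addrCA ltrDl addr_gt0.
have tn : t != 0 by rewrite gt_eqF.
have detw s (w : 'I_s -> int) : \sum_i w i = 0 -> \det (diag_mx (\row_j t ^ w j)) = 1.
  move=> w0; rewrite det_diag -[RHS](expr0z t) -w0.
  rewrite (big_morph (fun z : int => t ^ z) (fun x y => expfzDr x y tn) (expr0z t)).
  by apply: eq_bigr => i _; rewrite mxE.
exists (diag_mx (\row_j t ^ p j)), (diag_mx (\row_j t ^ q j)), (diag_mx (\row_j t ^ r j)).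
split; first by rewrite /inG !detw.
move=> x y z; rewrite act_diag !mxE subr0 -!expfzDr // normrM.
have [->|/hw] := eqVneq (psi x y z) 0; first by rewrite normr0 mulr0.
case: (p x + q y + r z) => // [[|w]] // _.
rewrite -exprnP normrX ger0_norm ?ltW //.
apply: le_lt_trans tM; apply: ler_pM => //; first by rewrite exprn_ge0 // ltW.
by rewrite exprS -[leRHS]mulr1 ler_pM // ?exprn_ge0 ?exprn_ile1 // ltW.
Qed.

End Tensors.

Lemma ord2P (i : 'I_2) : i = 0 \/ i = 1.
Proof. by case: i => [[|[|//]] h]; [left|right]; apply: val_inj. Qed.

Lemma sum2 (V : nmodType) (f : 'I_2 -> V) : \sum_(i < 2) f i = f 0 + f 1.
Proof. by rewrite !big_ord_recl big_ord0 addr0; congr (f _ + f _); apply: val_inj. Qed.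

Lemma sum_lt (m r : nat) : (r <= m)%N -> \sum_(j < m) ((j < r)%N%:Z) = r%:Z.
Proof.
move=> rm; rewrite -(big_morph _ PoszD (erefl 0%:Z)) -[r in RHS]card_ord -sum1_card.
rewrite (big_ord_widen m (fun=> 1%N) rm) //.
by congr Posz; rewrite [RHS]big_mkcond; apply: eq_bigr => i _; case: ltnP.
Qed.

(** * Changes of the pencil parameters and SL_2-invariance of the Sylvester determinant *)

Section Mix.
Variable F : numFieldType.

Definition mix m n (A : 'M[F]_2) (X0 X1 : 'M[F]_(m, n)) (i : 'I_2) :=
  A i 0 *: X0 + A i 1 *: X1.

Lemma mixM m n (A A' : 'M[F]_2) (X0 X1 : 'M[F]_(m, n)) i :
  mix (A *m A') X0 X1 i = mix A (mix A' X0 X1 0) (mix A' X0 X1 1) i.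
Proof.
by apply/matrixP=> j k; rewrite /mix !mxE !sum2; ring.
Qed.

Lemma mix1 m n (X0 X1 : 'M[F]_(m, n)) i :
  mix 1%:M X0 X1 i = if i == 0 then X0 else X1.
Proof.
by rewrite /mix !mxE; case: (ord2P i) => -> /=; rewrite scale1r scale0r ?addr0 ?add0r.
Qed.

Lemma mix_conj m n (A : 'M[F]_2) (X0 X1 : 'M[F]_(m, n)) (B : 'M[F]_m) (C : 'M[F]_n) i :
  mix A (B *m X0 *m C) (B *m X1 *m C) i = B *m mix A X0 X1 i *m C.
Proof. by rewrite /mix mulmxDr mulmxDl -!scalemxAr -!scalemxAl. Qed.

Lemma king_mix m n (A : 'M[F]_2) (X0 X1 : 'M[F]_(m, n)) : A \in unitmx ->
  king_semistable X0 X1 -> king_semistable (mix A X0 X1 0) (mix A X0 X1 1).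
Proof.
move=> uA sX p V; apply: leq_trans (sX p V) _; rewrite leq_mul2l; apply/orP; right.
apply: mxrankS.
have hX i : (V *m mix 1%:M X0 X1 i <= V *m mix A X0 X1 0 + V *m mix A X0 X1 1)%MS.
  rewrite -(mulVmx uA) mixM {1}/mix mulmxDr -!scalemxAr.
  by rewrite addmx_sub_adds ?scalemx_sub.
by rewrite addsmx_sub; have := hX 0; have := hX 1; rewrite !mix1 /= => -> ->.
Qed.

Definition upper (s : F) : 'M[F]_2 := 1%:M + s *: delta_mx 0 1.
Definition lower (s : F) : 'M[F]_2 := 1%:M + s *: delta_mx 1 0.

Lemma det2 (A : 'M[F]_2) : \det A = A 0 0 * A 1 1 - A 0 1 * A 1 0.
Proof.
rewrite (expand_det_row _ 0) sum2 /cofactor !det_mx11 !mxE /= expr0 expr1 mul1r.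
by rewrite mulN1r mulrN; congr (_ * A _ _ - _ * A _ _); apply: val_inj.
Qed.

Lemma mat2P (A B : 'M[F]_2) : A 0 0 = B 0 0 -> A 0 1 = B 0 1 ->
  A 1 0 = B 1 0 -> A 1 1 = B 1 1 -> A = B.
Proof.
move=> h0 h1 h2 h3; apply/matrixP=> i j.
by case: (ord2P i) => ->; case: (ord2P j) => ->.
Qed.

(** Elementary matrices generate SL_2: three suffice if the lower left entry is nonzero, and
    otherwise multiplying by [lower 1] makes it nonzero. *)
Lemma SL2_ind (P : 'M[F]_2 -> Prop) :
  (forall A B, \det A = 1 -> \det B = 1 -> P A -> P B -> P (A *m B)) ->
  (forall s, P (upper s)) -> (forall s, P (lower s)) ->
  forall A, \det A = 1 -> P A.
Proof.
move=> PM Pu Pl.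
have du s : \det (upper s) = 1 by rewrite det2 !mxE /=; ring.
have dl s : \det (lower s) = 1 by rewrite det2 !mxE /=; ring.
have main A : \det A = 1 -> A 1 0 != 0 -> P A.
  rewrite det2 => dA c0.
  have -> : A = upper ((A 0 0 - 1) / A 1 0) *m (lower (A 1 0) *m upper ((A 1 1 - 1) / A 1 0)).
    apply: mat2P; rewrite !(mxE, sum2) /=; try by field.
    have -> : A 0 1 = (A 0 0 * A 1 1 - 1) / A 1 0.
      by apply: (canRL (mulfK c0)); rewrite -dA; ring.
    by field.
  by apply: (PM _ _ _ _ (Pu _) (PM _ _ _ _ (Pl _) (Pu _))); rewrite ?det_mulmx ?du ?dl ?mulr1.
move=> A dA; have [c0|] := eqVneq (A 1 0) 0; last exact: main.
have -> : A = lower (-1) *m (lower 1 *m A) by apply: mat2P; rewrite !(mxE, sum2) /=; ring.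
have d1 : \det (lower 1 *m A) = 1 by rewrite det_mulmx dl mul1r.
apply: PM => //; apply: main => //; rewrite !(mxE, sum2) /= c0.
rewrite det2 c0 mulr0 subr0 in dA.
rewrite !(add0r, mulr1, mul1r, mulr0, addr0).
by apply/eqP=> h; move/eqP: dA; rewrite h mul0r eq_sym oner_eq0.
Qed.

Section HyperdetInvariance.
Variables (m n k : nat) (e : (k.+1 * m = k * n)%N) (X0 X1 : 'M[F]_(m, n)).
Hypotheses (lmn : (m < n)%N) (sX : king_semistable X0 X1).

Let hd (A : 'M[F]_2) := hyperdet e (mix A X0 X1 0) (mix A X0 X1 1).

Lemma king_hyperdet_neq0 : hyperdet e X0 X1 != 0.
Proof.
have [k' [ek _ inj]] := king_structure lmn sX.
have ekk : k' = k by nia.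
by apply: hyperdet_neq0; rewrite -ekk.
Qed.

Lemma mix_equiv A : A \in unitmx -> exists B C, [/\ B \in unitmx, C \in unitmx &
  forall i, mix A X0 X1 i = B *m mix 1%:M X0 X1 i *m C].
Proof.
move=> uA; have [B [C [uB uC e0 e1]]] := king_equiv lmn sX (king_mix uA sX).
exists B, C; split=> // i.
by rewrite mix1; case: (ord2P i) => -> /=; rewrite -?e0 -?e1.
Qed.

(** By [mix_equiv] the parameter change [A'] amounts to a row and column change, which multiplies
    all hyperdeterminants by one common factor. Hence [hd] divided by its value at the identity is a
    character of GL_2. *)
Lemma hyperdet_mixM A A' : A \in unitmx -> A' \in unitmx ->
  hd (A *m A') * hyperdet e X0 X1 = hd A * hd A'.
Proof.
move=> uA uA'; have [B [C [uB uC h]]] := mix_equiv uA'.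
by rewrite /hd !mixM !h !mix1 /= !mix_conj !hyperdetM; ring.
Qed.

Lemma hyperdet_mix_neq0 A : A \in unitmx -> hd A != 0.
Proof.
move=> uA; have [B [C [uB uC h]]] := mix_equiv uA.
rewrite /hd !h !mix1 /= hyperdetM !mulf_neq0 ?expf_neq0 ?king_hyperdet_neq0 //.
  by rewrite -unitfE -unitmxE.
by rewrite -unitfE -unitmxE.
Qed.

Lemma hyperdet_commutator U A A' : U \in unitmx -> A \in unitmx -> A' \in unitmx ->
  U *m (A *m A') = A' *m A -> hd U = hyperdet e X0 X1.
Proof.
move=> uU uA uA' eU; have uAA : A *m A' \in unitmx by rewrite unitmx_mul uA.
apply: (mulIf (hyperdet_mix_neq0 uAA)); rewrite -hyperdet_mixM // eU.
by rewrite hyperdet_mixM // [RHS]mulrC hyperdet_mixM // mulrC.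
Qed.

(* [SL_2] is perfect, so the character by which it scales [hyperdet] is trivial. *)
Lemma hyperdet_mix A : \det A = 1 -> hd A = hyperdet e X0 X1.
Proof.
have du s : \det (upper s) = 1 by rewrite det2 !mxE /=; ring.
have dl s : \det (lower s) = 1 by rewrite det2 !mxE /=; ring.
have un (M : 'M[F]_2) : \det M = 1 -> M \in unitmx by rewrite unitmxE => ->; apply: unitr1.
have n2 : (2 : F) != 0 by rewrite pnatr_eq0.
have n3 : (3 : F) != 0 by rewrite pnatr_eq0.
(* Conjugation by [g] multiplies the parameter of [upper] by 4 and that of [lower] by 1/4.
   Commutators with parameter [x] thus have parameter [3 x] and [- 3 x / 4]; solving for [s] gives
   the arguments used below. *)
pose g : 'M[F]_2 := diag_mx (\row_j (if j == 0 then 2 else 2^-1)).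
have dg : \det g = 1 by rewrite det2 !mxE /=; field.
move: A; apply: SL2_ind => [A B dA dB hA hB|s|s].
- by apply: (mulIf king_hyperdet_neq0); rewrite hyperdet_mixM ?un // hA hB.
- apply: (@hyperdet_commutator _ (upper (s / 3)) g); rewrite ?un //.
  by apply: mat2P; rewrite !(mxE, sum2) /=; field.
- apply: (@hyperdet_commutator _ (lower (- s * 4 / 3)) g); rewrite ?un //.
  by apply: mat2P; rewrite !(mxE, sum2) /=; field.
Qed.

End HyperdetInvariance.
End Mix.

(** * The case m < n *)

Section Wide.
Variables (R : realType) (m n : nat).
Implicit Types (psi phi : tensor R m n).

Lemma slice_act_mix A B C psi i :
  slice (act A B C psi) i
  = mix A (B *m slice psi 0 *m C^T) (B *m slice psi 1 *m C^T) i.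
Proof. by rewrite slice_act sum2. Qed.

(** In bases adapted to [V] and [W], a violation of King's inequality is a common zero block of size
    [r] by [n - q] in both slices, large enough for a one-parameter subgroup to destabilize the
    tensor. *)
Lemma semistable_king psi : semistable psi ->
  king_semistable (slice psi 0) (slice psi 1).
Proof.
move=> ss p V; rewrite leqNgt; apply/negP => hlt; apply: ss.
set W := (_ + _)%MS in hlt; set r := \rank V in hlt; set q := \rank W in hlt.
have rm : (r <= m)%N by apply: rank_leq_col.
have qn : (q <= n)%N by apply: rank_leq_col.
pose B := row_ebase V; pose C := (invmx (row_ebase W))^T.
have uC : C \in unitmx by rewrite unitmx_tr unitmx_inv row_ebase_unit.
apply: (nullcone_gl (unitmx1 _ _) (row_ebase_unit V) uC).
have hz i (j : 'I_m) (k : 'I_n) : (j < r)%N -> (q <= k)%N -> act 1%:M B C psi i j k = 0.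
  move=> jr qk.
  have hB : (row j B <= V)%MS.
    rewrite -[V in (_ <= V)%MS]mulmx_ebase rowE.
    have ra : (j < p)%N := leq_trans jr (rank_leq_row V).
    have -> : delta_mx 0 j = delta_mx 0 (Ordinal ra) *m pid_mx r :> 'rV[R[i]]_m.
      apply/rowP=> l; rewrite -rowE !mxE /= jr andbT.
      by congr (_%:R); rewrite eq_sym.
    apply/submxP; exists (delta_mx 0 (Ordinal ra) *m invmx (col_ebase V)).
    by rewrite -!mulmxA; congr (_ *m _); rewrite !mulmxA mulVmx ?col_ebase_unit // mul1mx.
  have hW : (row j B *m slice psi i <= W)%MS.
    apply: submx_trans (submxMr _ hB) _.
    by case: (ord2P i) => ->; [apply: addsmxSl|apply: addsmxSr].
  have : act 1%:M B C psi i j k = slice (act 1%:M B C psi) i j k by rewrite mxE.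
  rewrite slice_act (bigD1 i) //= big1 ?addr0 => [|a ai]; last first.
    by rewrite mxE eq_sym (negPf ai) scale0r.
  rewrite [1%:M _ _]mxE eqxx scale1r => ->.
  have [Y eY] := submxP hW.
  have -> : (B *m slice psi i *m C^T) j k = (row j B *m slice psi i *m C^T) 0 k.
    by rewrite -!row_mul [RHS]mxE.
  rewrite eY -[W in Y *m W]mulmx_ebase trmxK !mulmxA mulmxK ?row_ebase_unit //.
  rewrite mxE big1 // => l _.
  by rewrite !mxE ltnNge; case: eqP => [->|]; rewrite ?qk /= ?mulr0.
(* All weights off the zero block are at least [n r - m q > 0]. *)
apply: (@weights_nullcone R m n (fun=> 0)
  (fun j => (n * r)%:Z - (n * m)%:Z * ((j < r)%N)%:Z)
  (fun k => (n * m)%:Z * ((k < q)%N)%:Z - (m * q)%:Z)).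
- by rewrite big1.
- by rewrite sumrB -mulr_sumr sum_lt // sumr_const card_ord; lia.
- by rewrite sumrB -mulr_sumr sum_lt // sumr_const card_ord; lia.
move=> i j k ne; rewrite add0r.
have : ~~ ((j < r)%N && (q <= k)%N) by apply: contra ne => /andP[jr qk]; rewrite hz.
case: ltnP => _ /=; last by move=> _; case: ltnP => _ /=; lia.
by rewrite -ltnNge => -> /=; lia.
Qed.

Lemma cont_cast a b a' b' (e : (a = a') * (b = b')) (M : tensor R m n -> 'M[R[i]]_(a, b)) :
  cont_mx M -> cont_mx (fun psi => castmx e (M psi)).
Proof. by move=> cM i j; under eq_fun do rewrite castmxE; apply: cM. Qed.

Lemma cont_col_mx a1 a2 b (M1 : tensor R m n -> 'M[R[i]]_(a1, b)) (M2 : tensor R m n -> 'M[R[i]]_(a2, b)) :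
  cont_mx M1 -> cont_mx M2 -> cont_mx (fun psi => col_mx (M1 psi) (M2 psi)).
Proof.
move=> c1 c2 i j; under eq_fun do rewrite mxE.
by case: (split i) => i'; [apply: c1|apply: c2].
Qed.

Lemma cont_row_mx a b1 b2 (M1 : tensor R m n -> 'M[R[i]]_(a, b1)) (M2 : tensor R m n -> 'M[R[i]]_(a, b2)) :
  cont_mx M1 -> cont_mx M2 -> cont_mx (fun psi => row_mx (M1 psi) (M2 psi)).
Proof.
move=> c1 c2 i j; under eq_fun do rewrite mxE.
by case: (split j) => j'; [apply: c1|apply: c2].
Qed.

Lemma cont_mx_const a b (M : 'M[R[i]]_(a, b)) : cont_mx (fun _ : tensor R m n => M).
Proof. by move=> i j; apply: cont_const. Qed.

Lemma cont_sylvester k : cont_mx (fun psi => sylvester k (slice psi 0) (slice psi 1)).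
Proof.
elim: k => [|k IH]; first exact: cont_mx_const.
apply: cont_col_mx; apply: cont_row_mx => //.
- exact: cont_slice.
- exact: cont_mx_const.
by apply: cont_col_mx; [apply: cont_slice|apply: cont_mx_const].
Qed.

Lemma cont_hyperdet k (e : (k.+1 * m = k * n)%N) :
  cont (fun psi => hyperdet e (slice psi 0) (slice psi 1)).
Proof. exact/cont_det/cont_cast/cont_sylvester. Qed.

Lemma wide_closed psi phi : (0 < m)%N -> (m < n)%N -> semistable psi ->
  in_orbit_closure psi phi -> Defs.in_orbit psi phi.
Proof.
move=> m0 lmn ss cl.
have ss' : semistable phi by move=> h; apply: ss; apply: nullcone_closure cl h.
have sX := semistable_king ss; have sY := semistable_king ss'.
have [B [C [uB uC e0 e1]]] := king_equiv lmn sX sY.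
have [k [ek stab _]] := king_structure lmn sX.
have e : (k.+1 * m = k * n)%N by nia.
have h0 := king_hyperdet_neq0 e lmn sX.
have : hyperdet e (slice phi 0) (slice phi 1) = hyperdet e (slice psi 0) (slice psi 1).
  apply: (invariant_closure (cont_hyperdet e)) cl => A B' C' [dA [dB dC]].
  by rewrite !slice_act_mix !mix_conj hyperdetM dB det_tr dC !expr1n mul1r mulr1 hyperdet_mix.
rewrite -e0 -e1 hyperdetM mulrAC -[RHS]mul1r => /(mulIf h0) hd.
have dB : \det B != 0 by rewrite -unitfE -unitmxE.
have dC : \det C != 0 by rewrite -unitfE -unitmxE.
(* Equal hyperdeterminants mean [\det B ^+ k.+1 * \det C ^+ k = 1]. For this [h] the stabilizer
   [(b, c)] therefore has determinants inverse to those of [B] and [C]. *)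
have hh : (\det B * \det C)^-1 != 0 by rewrite invr_eq0 mulf_neq0.
have [b [c [eb0 eb1 db dc]]] := stab _ hh.
have eh : (\det B * \det C) ^+ k = (\det B)^-1.
  by apply: (mulfI dB); rewrite mulfV // exprMn mulrA -exprS.
exists 1%:M, (B *m b), (c *m C)^T; split.
  rewrite /inG det1 det_tr !det_mulmx db dc exprVn invrK exprS exprVn eh.
  by rewrite invrK mulfV //; split=> //; split=> //; field; rewrite dB dC.
apply: slice_inj => i; rewrite slice_act_mix mix1 trmxK.
by case: (ord2P i) => -> /=; [rewrite -e0 -[in RHS]eb0|rewrite -e1 -[in RHS]eb1]; rewrite !mulmxA.
Qed.

End Wide.

(** * Diagonalization of regular pencils *)

Section Regular.
Variable F : numClosedFieldType.

(* A nonzero form [a x + b y] violating this condition is a double zero of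
   [det (x X0 + y X1)], which may vanish identically. *)
Definition regular n (X0 X1 : 'M[F]_n) : Prop :=
  forall (a b : F) (u : 'rV[F]_n) (w : 'cV[F]_n), (a != 0) || (b != 0) ->
  u != 0 -> w != 0 ->
  u *m (a *: X0 + b *: X1) = 0 -> (a *: X0 + b *: X1) *m w = 0 ->
  u *m X0 *m w = 0 -> u *m X1 *m w = 0 -> False.

Lemma col_completion n (z : 'cV[F]_n.+1) : z != 0 ->
  exists2 G : 'M[F]_n.+1, G \in unitmx & G *m z = delta_mx 0 0.
Proof.
move=> z0; have r1 : \rank z = 1%N.
  by apply/eqP; rewrite eqn_leq rank_leq_col lt0n mxrank_eq0.
have ez := mulmx_ebase z; rewrite r1 in ez.
have [c ec] : exists c, row_ebase z = c%:M by exists (row_ebase z 0 0); apply: mx11_scalar.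
have c0 : c != 0.
  by have := row_ebase_unit z; rewrite ec unitmxE det_scalar1 unitfE.
exists (c^-1 *: invmx (col_ebase z)).
  by rewrite unitmxZ ?unitmx_inv ?col_ebase_unit // unitfE invr_eq0.
rewrite -scalemxAl -[z in _ *m z]ez !mulmxA mulVmx ?col_ebase_unit // mul1mx.
rewrite ec mul_mx_scalar scalerA mulVf // scale1r.
by apply/colP=> i; rewrite !mxE; case: i => [[|i] h].
Qed.

(** Start from any [G] sending [z] to the first basis vector [e0] and correct it by a shear
    [1 + e0 y] with [y e0 = 0]. The shear fixes [e0], and [u z = 1] lets it prescribe the first
    row. *)
Lemma dual_completion n (u : 'rV[F]_n.+1) (z : 'cV[F]_n.+1) : u *m z = 1%:M ->
  exists2 B : 'M[F]_n.+1, B \in unitmx &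
    delta_mx 0 0 *m B = u /\ B *m z = delta_mx 0 0.
Proof.
move=> uz.
have z0 : z != 0.
  apply/eqP=> z0; move: uz; rewrite z0 mulmx0 => /matrixP/(_ 0 0)/eqP.
  by rewrite !mxE eq_sym oner_eq0.
have [G uG Gz] := col_completion z0.
pose e0 : 'cV[F]_n.+1 := delta_mx 0 0; pose e0' : 'rV[F]_n.+1 := delta_mx 0 0.
have ee : e0' *m e0 = 1%:M.
  by rewrite mul_delta_mx; apply/matrixP=> i j; rewrite !ord1 !mxE.
have [y ye ey] : exists2 y : 'rV_n.+1, y *m e0 = 0 & e0' + y = u *m invmx G.
  exists (u *m invmx G - e0'); last by rewrite addrC subrK.
  by rewrite mulmxBl ee /e0 -Gz -mulmxA (mulmxA (invmx G)) mulVmx // mul1mx uz subrr.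
have uH : 1%:M + e0 *m y \in unitmx.
  have h : (1%:M + e0 *m y) *m (1%:M - e0 *m y) = 1%:M.
    rewrite mulmxDl mul1mx mulmxBr mulmx1 -mulmxA (mulmxA y) ye mul0mx mulmx0 subr0.
    by rewrite subrK.
  by have [] := mulmx1_unit h.
exists ((1%:M + e0 *m y) *m G); first by rewrite unitmx_mul uH.
split.
  by rewrite mulmxA mulmxDr mulmx1 mulmxA ee mul1mx ey mulmxKV.
by rewrite -mulmxA Gz mulmxDl mul1mx -mulmxA ye mulmx0 addr0.
Qed.

Lemma pencil_comb n (A : 'M[F]_2) (X0 X1 : 'M[F]_n) a b :
  a *: mix A X0 X1 0 + b *: mix A X0 X1 1
  = (a * A 0 0 + b * A 1 0) *: X0 + (a * A 0 1 + b * A 1 1) *: X1.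
Proof. by apply/matrixP=> i j; rewrite /mix !mxE; ring. Qed.

Lemma regular_mix n (A : 'M[F]_2) (X0 X1 : 'M[F]_n) : A \in unitmx ->
  regular X0 X1 -> regular (mix A X0 X1 0) (mix A X0 X1 1).
Proof.
rewrite unitmxE unitfE det2 => dA rX a b u w ab u0 w0.
rewrite pencil_comb => h1 h2 h3 h4.
have hX : u *m X0 *m w = 0 /\ u *m X1 *m w = 0.
  move: h3 h4; rewrite /mix !mulmxDr !mulmxDl -!scalemxAr -!scalemxAl.
  set x := u *m X0 *m w; set y := u *m X1 *m w => h3 h4.
  have e0 : (A 0 0 * A 1 1 - A 0 1 * A 1 0) *: x =
    A 1 1 *: (A 0 0 *: x + A 0 1 *: y) - A 0 1 *: (A 1 0 *: x + A 1 1 *: y).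
    by apply/matrixP=> i j; rewrite !mxE; ring.
  have e1 : (A 0 0 * A 1 1 - A 0 1 * A 1 0) *: y =
    A 0 0 *: (A 1 0 *: x + A 1 1 *: y) - A 1 0 *: (A 0 0 *: x + A 0 1 *: y).
    by apply/matrixP=> i j; rewrite !mxE; ring.
  rewrite h3 h4 !scaler0 subrr in e0 e1.
  by move/eqP: e0; move/eqP: e1; rewrite !scaler_eq0 (negPf dA) /= => /eqP-> /eqP->.
apply: (rX _ _ u w _ u0 w0 h1 h2 hX.1 hX.2).
rewrite -negb_and; apply: contraTN ab => /andP[/eqP s /eqP t].
have ea : (A 0 0 * A 1 1 - A 0 1 * A 1 0) * a = 0.
  transitivity (A 1 1 * (a * A 0 0 + b * A 1 0) - A 1 0 * (a * A 0 1 + b * A 1 1)).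
    by ring.
  by rewrite s t !mulr0 subrr.
have eb : (A 0 0 * A 1 1 - A 0 1 * A 1 0) * b = 0.
  transitivity (A 0 0 * (a * A 0 1 + b * A 1 1) - A 0 1 * (a * A 0 0 + b * A 1 0)).
    by ring.
  by rewrite s t !mulr0 subrr.
move/eqP: ea; move/eqP: eb; rewrite !mulf_eq0 (negPf dA) /= => /eqP-> /eqP->.
by rewrite eqxx.
Qed.

Lemma conj_comb m n (B : 'M[F]_m) (C : 'M[F]_n) (X0 X1 : 'M[F]_(m, n)) a b :
  a *: (B *m X0 *m C) + b *: (B *m X1 *m C) = B *m (a *: X0 + b *: X1) *m C.
Proof. by rewrite mulmxDr mulmxDl -!scalemxAr -!scalemxAl. Qed.

Lemma regular_conj n (B C X0 X1 : 'M[F]_n) : B \in unitmx -> C \in unitmx ->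
  regular X0 X1 -> regular (B *m X0 *m C) (B *m X1 *m C).
Proof.
move=> uB uC rX a b u w ab u0 w0.
rewrite conj_comb !mulmxA => h1 h2 h3 h4.
apply: (rX a b (u *m B) (C *m w) ab); rewrite ?mulmxA //.
- by apply: contraNneq u0 => h; rewrite -(mulmxK uB u) h mul0mx.
- by apply: contraNneq w0 => h; rewrite -(mulKmx uC w) h mulmx0.
- by rewrite -(mulmxK uC (_ *m _)) h1 mul0mx.
by apply: (can_inj (mulKmx uB)); rewrite mulmx0 !mulmxA.
Qed.

Lemma regular_block n (c0 c1 : 'M[F]_1) (Z0 Z1 : 'M[F]_n) :
  regular (block_mx c0 0 0 Z0) (block_mx c1 0 0 Z1) -> regular Z0 Z1.
Proof.
move=> rX a b u w ab u0 w0 h1 h2 h3 h4.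
apply: (rX a b (row_mx 0 u) (col_mx 0 w) ab).
- by apply: contraNneq u0 => h; rewrite -(row_mxKr (0 : 'M_1) u) h linear0.
- by apply: contraNneq w0 => h; rewrite -(col_mxKd (0 : 'M_1) w) h linear0.
- rewrite !scale_block_mx add_block_mx !scaler0 !addr0 mul_row_block.
  by rewrite !mul0mx !mulmx0 h1 !addr0 row_mx0.
- rewrite !scale_block_mx add_block_mx !scaler0 !addr0 mul_block_col.
  by rewrite !mul0mx !mulmx0 h2 !addr0 col_mx0.
- by rewrite mul_row_block !mul0mx !mulmx0 !add0r mul_row_col mulmx0 add0r.
by rewrite mul_row_block !mul0mx !mulmx0 !add0r mul_row_col mulmx0 add0r.
Qed.

Lemma block_of_axis n (M : 'M[F]_(1 + n)) (c : F) :
  delta_mx 0 0 *m M = c *: delta_mx 0 0 :> 'rV_(1 + n) ->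
  M *m delta_mx 0 0 = c *: delta_mx 0 0 :> 'cV_(1 + n) ->
  M = block_mx c%:M 0 0 (drsubmx M).
Proof.
move=> hr hc.
have er j : M 0 j = c * (j == 0)%:R.
  by have /rowP/(_ j) := hr; rewrite -rowE !mxE eqxx.
have ec i : M i 0 = c * (i == 0)%:R.
  by have /colP/(_ i) := hc; rewrite -colE !mxE eqxx andbT.
have l0 : lshift n (0 : 'I_1) = 0 by apply: val_inj.
rewrite -[LHS]submxK; congr block_mx; apply/matrixP=> i j; rewrite !mxE ?ord1 l0.
- by rewrite er eqxx mulr1.
- by rewrite er mulr0.
by rewrite ec mulr0.
Qed.

Lemma singular_member n (X0 X1 : 'M[F]_n.+1) :
  exists a b, ((a != 0) || (b != 0)) /\ \det (a *: X0 + b *: X1) = 0.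
Proof.
have [d0|d0] := eqVneq (\det X1) 0.
  by exists 0, 1; rewrite oner_eq0 orbT scale0r add0r scale1r.
have uX : X1 \in unitmx by rewrite unitmxE unitfE.
have /closed_rootP[x] : size (char_poly (X0 *m invmx X1)) != 1%N by rewrite size_char_poly.
rewrite -eigenvalue_root_char => /eigenvalueP[v hv v0].
exists 1, (- x); rewrite oner_eq0; split=> //; apply/eqP/det0P.
exists v => //; rewrite scale1r mulmxDr scaleNr mulmxN -scalemxAr scalemxAl -hv.
by rewrite mulmxA mulmxKV // subrr.
Qed.

Lemma completion2 (a b : F) : (a != 0) || (b != 0) ->
  exists2 S : 'M[F]_2, S \in unitmx & S 1 0 = a /\ S 1 1 = b.
Proof.
move=> ab.
exists (\matrix_(i, j) (if i == 1 then (if j == 0 then a else b)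
   else if a != 0 then (j == 1)%:R else (j == 0)%:R)); last by rewrite !mxE.
rewrite unitmxE unitfE det2 !mxE /=; move: ab.
by have [->|a0] := eqVneq a 0; rewrite /= ?(mul0r, mul1r, mulr0, subr0, sub0r, oppr_eq0).
Qed.

(** Let [u] and [w] be left and right null vectors of a singular member [Y1]. Regularity forces
    [u Y0 w] to be nonzero, so in bases dual to [Y0 w] and [u Y0] a block with entries 1 in [Y0] and
    0 in [Y1] splits off, and the complementary block is again regular. *)
Lemma regular_diag n (X0 X1 : 'M[F]_n) : regular X0 X1 ->
  exists B C d0 d1, [/\ B \in unitmx, C \in unitmx,
    B *m X0 *m C = diag_mx d0 & B *m X1 *m C = diag_mx d1].
Proof.
elim: n X0 X1 => [|n IH] X0 X1.
  by move=> _; exists 1%:M, 1%:M, 0, 0; rewrite unitmx1; split=> //; apply/matrixP=> [[]].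
have core (Y0 Y1 : 'M[F]_n.+1) : \det Y1 = 0 -> regular Y0 Y1 ->
  exists B C d0 d1, [/\ B \in unitmx, C \in unitmx,
    B *m Y0 *m C = diag_mx d0 & B *m Y1 *m C = diag_mx d1].
  move=> dY rY.
  have [u u0 uY] : exists2 u : 'rV_n.+1, u != 0 & u *m Y1 = 0 by apply/det0P; rewrite dY.
  have [v v0 vY] : exists2 v : 'rV_n.+1, v != 0 & v *m Y1^T = 0.
    by apply/det0P; rewrite det_tr dY.
  have wY : Y1 *m v^T = 0 by apply: trmx_inj; rewrite trmx_mul trmxK vY trmx0.
  have w0 : v^T != 0 by rewrite -trmx0 (inj_eq trmx_inj).
  pose c := (u *m Y0 *m v^T) 0 0.
  have ec : u *m Y0 *m v^T = c%:M by apply: mx11_scalar.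
  have c0 : c != 0.
    apply/eqP=> c0; apply: (rY 0 1 u v^T) => //; rewrite ?oner_eq0 ?orbT //.
    - by rewrite scale0r add0r scale1r.
    - by rewrite scale0r add0r scale1r.
    - by rewrite ec c0 raddf0.
    by rewrite uY mul0mx.
  pose u' := c^-1 *: u.
  have e1 : u' *m (Y0 *m v^T) = 1%:M.
    by rewrite /u' -scalemxAl mulmxA ec scale_scalar_mx mulVf.
  have uY' : u' *m Y1 = 0 by rewrite /u' -scalemxAl uY scaler0.
  have [B uB [eB BY]] := dual_completion e1.
  have e2 : v *m (u' *m Y0)^T = 1%:M.
    by apply: trmx_inj; rewrite trmx_mul trmxK tr_scalar_mx -mulmxA.
  have [D uD [eD DY]] := dual_completion e2.
  have eD' : D^T *m delta_mx 0 0 = v^T by rewrite -eD trmx_mul trmx_delta.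
  have DY' : u' *m Y0 *m D^T = delta_mx 0 0.
    by apply: trmx_inj; rewrite trmx_mul trmxK DY trmx_delta.
  have h0 := @block_of_axis n (B *m Y0 *m D^T) 1.
  have h1 := @block_of_axis n (B *m Y1 *m D^T) 0.
  rewrite -[n.+1]/(1 + n)%N in B uB eB BY D uD eD DY eD' DY' h0 h1 *.
  have {}h0 : B *m Y0 *m D^T = block_mx 1%:M 0 0 (drsubmx (B *m Y0 *m D^T)).
    by apply: h0; rewrite scale1r ?mulmxA ?eB ?DY' // -!mulmxA eD' BY.
  have {}h1 : B *m Y1 *m D^T = block_mx 0%:M 0 0 (drsubmx (B *m Y1 *m D^T)).
    by apply: h1; rewrite scale0r ?mulmxA ?eB ?uY' ?mul0mx // -!mulmxA eD' wY mulmx0.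
  have uDt : D^T \in unitmx by rewrite unitmx_tr.
  have := regular_conj uB uDt rY; rewrite h0 h1 => /regular_block/IH.
  move=> [B' [C' [d0 [d1 [uB' uC' f0 f1]]]]].
  exists (block_mx 1%:M 0 0 B' *m B), (D^T *m block_mx 1%:M 0 0 C').
  exists (row_mx (const_mx 1) d0), (row_mx (const_mx 0) d1).
  have ub M : M \in unitmx -> block_mx (1%:M : 'M[F]_1) 0 0 (M : 'M[F]_n) \in unitmx.
    by rewrite !unitmxE det_ublock det1 mul1r.
  split; first by rewrite unitmx_mul ub.
  - by rewrite unitmx_mul uDt ub.
  - rewrite -!mulmxA (mulmxA Y0) (mulmxA B) (mulmxA B) h0 !mulmx_block diag_mx_row diag_const_mx.
    by rewrite !(mul0mx, mulmx0, mul1mx, mulmx1, addr0, add0r) mulmxA f0.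
  - rewrite -!mulmxA (mulmxA Y1) (mulmxA B) (mulmxA B) h1 !mulmx_block diag_mx_row diag_const_mx.
    by rewrite !(mul0mx, mulmx0, mul1mx, mulmx1, addr0, add0r) mulmxA f1.
move=> rX; have [a [b [ab dX]]] := singular_member X0 X1.
have [S uS [Sa Sb]] := completion2 ab.
have [|B [C [d0 [d1 [uB uC e0 e1]]]]] := core _ _ _ (regular_mix uS rX).
  by rewrite /mix Sa Sb.
have h i : B *m mix 1%:M X0 X1 i *m C
    = diag_mx (invmx S i 0 *: d0 + invmx S i 1 *: d1).
  by rewrite -(mulVmx uS) mixM -mix_conj e0 e1 /mix linearP /= linearZ.
exists B, C, (invmx S 0 0 *: d0 + invmx S 0 1 *: d1), (invmx S 1 0 *: d0 + invmx S 1 1 *: d1).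
by split=> //; rewrite -h mix1.
Qed.

(** If two diagonal forms were proportional, some member would vanish at both places. The basis row
    [i] and the basis column [j] would then be null vectors of it, and they annihilate every
    diagonal matrix since [i != j]. *)
Lemma regular_diag_indep n (d0 d1 : 'rV[F]_n) i j :
  regular (diag_mx d0) (diag_mx d1) -> i != j ->
  d0 0 i * d1 0 j - d1 0 i * d0 0 j != 0.
Proof.
move=> rd ij; apply/eqP=> /subr0_eq h.
have key a b : (a != 0) || (b != 0) -> a * d0 0 i + b * d1 0 i = 0 ->
    a * d0 0 j + b * d1 0 j = 0 -> False.
  move=> ab hi hj.
  have e : a *: diag_mx d0 + b *: diag_mx d1 = diag_mx (a *: d0 + b *: d1).
    by rewrite linearP /= linearZ.
  have off (d : 'rV[F]_n) : delta_mx 0 i *m diag_mx d *m delta_mx j 0 = 0 :> 'M_1.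
    apply/matrixP=> x y; rewrite !ord1 -rowE -colE !mxE.
    by rewrite (negPf ij) mulr0n.
  apply: (rd a b (delta_mx 0 i) (delta_mx j 0)) => //.
  - by apply/eqP=> /matrixP/(_ 0 i)/eqP; rewrite !mxE !eqxx oner_eq0.
  - by apply/eqP=> /matrixP/(_ j 0)/eqP; rewrite !mxE !eqxx oner_eq0.
  - rewrite e -rowE; apply/rowP=> k; rewrite !mxE.
    by rewrite hi mul0rn.
  rewrite e -colE; apply/colP=> k; rewrite !mxE.
  by case: eqP => [->|]; rewrite ?hj ?mulr0n ?mul0rn.
have [j0|j0] := boolP ((d1 0 j != 0) || (- d0 0 j != 0)).
  by apply: (key _ _ j0); [rewrite mulNr [X in X - _]mulrC h [d0 0 j * _]mulrC subrr|ring].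
have [i0|i0] := boolP ((d1 0 i != 0) || (- d0 0 i != 0)).
  by apply: (key _ _ i0); [ring|rewrite mulNr -h subrr].
move: i0 j0; rewrite !negb_or !negbK !oppr_eq0 => /andP[/eqP a1 /eqP a0] /andP[/eqP b1 /eqP b0].
by apply: (key 1 0); rewrite ?oner_eq0 // ?a0 ?a1 ?b0 ?b1 !mulr0 addr0.
Qed.

End Regular.

(** * Square pencils of size at most 3 *)

Lemma semistable_regular (R : realType) n (psi : tensor R n n) :
  (2 <= n <= 3)%N -> semistable psi -> regular (slice psi 0) (slice psi 1).
Proof.
case: n psi => // n psi hn ss a b u w ab u0 w0 h1 h2 h3 h4; apply: ss.
have [S uS [Sa Sb]] := completion2 ab.
have [G uG Gu] : exists2 G : 'M_n.+1, G \in unitmx & G *m u^T = delta_mx 0 0.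
  by apply: col_completion; rewrite -trmx0 (inj_eq trmx_inj).
have [H uH Hw] := col_completion w0.
pose B := (invmx G)^T; pose C := (invmx H)^T.
have eB : delta_mx 0 0 *m B = u.
  by apply: trmx_inj; rewrite trmx_mul trmxK trmx_delta -Gu mulKmx.
have eC : C^T *m delta_mx 0 0 = w by rewrite trmxK -Hw mulKmx.
have uB : B \in unitmx by rewrite unitmx_tr unitmx_inv.
have uC : C \in unitmx by rewrite unitmx_tr unitmx_inv.
apply: (nullcone_gl uS uB uC).
set phi := act S B C psi.
have s1 : slice phi 1 = B *m (a *: slice psi 0 + b *: slice psi 1) *m C^T.
  by rewrite slice_act_mix mix_conj /mix Sa Sb.
have r1 k : phi 1 0 k = 0.
  have -> : phi 1 0 k = ((delta_mx 0 0 : 'rV_n.+1) *m slice phi 1) 0 k by rewrite -rowE !mxE.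
  by rewrite s1 !mulmxA eB h1 mul0mx mxE.
have c1 j : phi 1 j 0 = 0.
  have -> : phi 1 j 0 = (slice phi 1 *m (delta_mx 0 0 : 'cV_n.+1)) j 0 by rewrite -colE !mxE.
  by rewrite s1 -!mulmxA eC h2 mulmx0 mxE.
have z0 : phi 0 0 0 = 0.
  have -> : phi 0 0 0 = ((delta_mx 0 0 : 'rV_n.+1) *m slice phi 0 *m (delta_mx 0 0 : 'cV_n.+1)) 0 0.
    by rewrite -rowE -colE !mxE.
  rewrite slice_act_mix mix_conj !mulmxA eB -(mulmxA _ C^T) eC /mix.
  by rewrite mulmxDr mulmxDl -!scalemxAr -!scalemxAl h3 h4 !scaler0 addr0 mxE.
(* For size [N = n.+1], entries of slice 0 in the first row or column have weight [7 - 2 N],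
   positive only for [N <= 3]. The other possibly nonzero entries have weight 7 in slice 0 and 1 in
   slice 1. *)
apply: (@weights_nullcone R n.+1 n.+1 (fun i => if i == 0 then 3 else -3)
  (fun j => if j == 0 then 2 - (2 * n.+1)%:Z else 2)
  (fun j => if j == 0 then 2 - (2 * n.+1)%:Z else 2)).
- by rewrite sum2.
- rewrite big_ord_recl /= (eq_bigr (fun=> 2)) => [|i _]; last by [].
  by rewrite sumr_const card_ord; lia.
- rewrite big_ord_recl /= (eq_bigr (fun=> 2)) => [|i _]; last by [].
  by rewrite sumr_const card_ord; lia.
move=> i j k; case: (ord2P i) => -> /=.
  have [->|_] := eqVneq j 0; have [->|_] := eqVneq k 0; rewrite ?z0 ?eqxx //; lia.
have [->|_] := eqVneq j 0; first by rewrite r1 eqxx.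
have [->|_] := eqVneq k 0; first by rewrite c1 eqxx.
lia.
Qed.

(** * Normal forms of square pencils of size 2 and 3 *)

Section Canonical.
Variable R : realType.
Local Notation F := R[i].

(* The pencil [diag(x, y)] for [n = 2] and [diag(x, y, x + y)] for [n = 3]. *)
Definition diag_tensor n : tensor R n n := fun i j k =>
  if j == k then
    if (j == 0 :> nat) then (i == 0)%:R
    else if (j == 1 :> nat) then (i == 1)%:R else 1
  else 0.
Arguments diag_tensor : clear implicits.

Lemma slice_canon2 i : slice (diag_tensor 2) i = diag_mx (delta_mx 0 i).
Proof.
apply/matrixP=> j k; rewrite !mxE /diag_tensor.
by case: (ord2P j) => ->; case: (ord2P k) => ->; case: (ord2P i) => ->.
Qed.

Definition ord30 : 'I_3 := @Ordinal 3 0 isT.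
Definition ord31 : 'I_3 := @Ordinal 3 1 isT.
Definition ord32 : 'I_3 := @Ordinal 3 2 isT.

Lemma ord3P (P : 'I_3 -> Prop) : P ord30 -> P ord31 -> P ord32 -> forall i, P i.
Proof.
by move=> h0 h1 h2 [[|[|[|//]]] h]; [move: h0|move: h1|move: h2];
  congr P; apply: val_inj.
Qed.

Definition row3 (x y z : F) : 'rV[F]_3 :=
  \row_j (if j == ord30 then x else if j == ord31 then y else z).

Lemma slice_canon3 i : slice (diag_tensor 3) i = diag_mx (row3 (i == 0)%:R (i == 1)%:R 1).
Proof.
apply/matrixP=> j k; rewrite !mxE /diag_tensor.
by elim/ord3P: j => //; elim/ord3P: k.
Qed.

Lemma canon_regular n (psi : tensor R n n) : (2 <= n <= 3)%N ->
  regular (slice psi 0) (slice psi 1) ->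
  exists A B C, [/\ A \in unitmx, B \in unitmx, C \in unitmx &
    psi = act A B C (diag_tensor n)].
Proof.
move=> hn rX; have [B [C [d0 [d1 [uB uC e0 e1]]]]] := regular_diag rX.
have uC' : C^T \in unitmx by rewrite unitmx_tr.
have rd : regular (diag_mx d0) (diag_mx d1).
  by rewrite -e0 -e1; apply: regular_conj.
suff [A [E [uA uE eA]]] : exists A E, [/\ A \in unitmx, E \in unitmx &
    act 1%:M (E *m B) C^T psi = act A 1%:M 1%:M (diag_tensor n)].
  exists A, (invmx (E *m B)), (invmx C^T).
  rewrite !unitmx_inv unitmx_mul uE uB uC' uA; split=> //.
  have -> : act A (invmx (E *m B)) (invmx C^T) (diag_tensor n) =
     act 1%:M (invmx (E *m B)) (invmx C^T) (act A 1%:M 1%:M (diag_tensor n)).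
    by rewrite actM mul1mx !mulmx1.
  by rewrite -eA actM mul1mx !mulVmx ?unitmx_mul ?uE // act1.
have ind := regular_diag_indep rd.
have eX E i : slice (act 1%:M (E *m B) C^T psi) i
     = E *m diag_mx (if i == 0 then d0 else d1).
  rewrite slice_act_mix mix1 trmxK; case: (ord2P i) => -> /=.
    by rewrite -e0 !mulmxA.
  by rewrite -e1 !mulmxA.
have eA A i : slice (act A 1%:M 1%:M (diag_tensor n)) i
     = A i 0 *: slice (diag_tensor n) 0 + A i 1 *: slice (diag_tensor n) 1.
  by rewrite slice_act_mix trmx1 !mulmx1 !mul1mx.
have {hn} : n = 2 \/ n = 3 by lia.
case=> en; subst n.
  exists (\matrix_(i, j) (if i == 0 then d0 0 j else d1 0 j)), 1%:M.
  rewrite unitmx1 unitmxE det2 !mxE /= unitfE; split=> //.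
    by rewrite [d0 0 1 * _]mulrC; apply: ind.
  apply: slice_inj => i; rewrite eX eA !slice_canon2 mul1mx !mxE.
  apply/matrixP=> j k; rewrite !mxE.
  by case: (ord2P j) => ->; case: (ord2P k) => ->; case: (ord2P i) => -> /=;
    rewrite ?mulr0n ?mulr1n ?mulr0 ?mulr1 ?addr0 ?add0r.
pose dl := d0 0 ord30 * d1 0 ord31 - d1 0 ord30 * d0 0 ord31.
have dl0 : dl != 0 by apply: ind.
(* Cramer's rule: the third diagonal form is [al] times the first plus [be] times the second.
   Rescaling the first two rows by these nonzero factors gives the shape [x], [y], [x + y]. *)
pose al := (d0 0 ord32 * d1 0 ord31 - d1 0 ord32 * d0 0 ord31) / dl.
pose be := (d0 0 ord30 * d1 0 ord32 - d1 0 ord30 * d0 0 ord32) / dl.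
have al0 : al != 0 by rewrite mulf_neq0 ?invr_eq0 //; apply: ind.
have be0 : be != 0 by rewrite mulf_neq0 ?invr_eq0 //; apply: ind.
pose A : 'M[F]_2 := \matrix_(i, j) ((if j == 0 then al else be) *
  (if i == 0 then d0 else d1) 0 (if j == 0 then ord30 else ord31)).
exists A, (diag_mx (row3 al be 1)); split.
- rewrite unitmxE det2 !mxE /= unitfE.
  have -> : al * d0 0 ord30 * (be * d1 0 ord31) - be * d0 0 ord31 * (al * d1 0 ord30)
    = al * be * dl by rewrite /dl; ring.
  exact: (mulf_neq0 (mulf_neq0 al0 be0) dl0).
- rewrite unitmxE det_diag unitfE !big_ord_recl big_ord0 !mxE /= mulr1.
  exact: (mulf_neq0 al0 (mulf_neq0 be0 (oner_neq0 _))).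
apply: slice_inj => i; rewrite eX eA !slice_canon3.
apply/matrixP=> j k; rewrite mul_diag_mx !mxE.
case: (ord2P i) => ->; elim/ord3P: j; elim/ord3P: k => /=; rewrite ?mulr0n ?mulr1n;
  rewrite ?(mulr0, mulr1, addr0, add0r, mul1r) //; rewrite /al /be; move: dl0; rewrite /dl => dl0; field.
all: exact: dl0.
Qed.

Lemma unit_scale s (A : 'M[F]_s.+1) : A \in unitmx ->
  exists a A1, [/\ a != 0, \det A1 = 1 & A = a *: A1].
Proof.
rewrite unitmxE unitfE => dA.
pose a := s.+1.-root (\det A).
have ea : a ^+ s.+1 = \det A by rewrite rootCK.
have a0 : a != 0 by apply: contraNneq dA => a0; rewrite -ea a0 expr0n.
exists a, (a^-1 *: A); split=> //.
  by rewrite detZ exprVn ea mulVf.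
by rewrite scalerA mulfV // scale1r.
Qed.

Definition tscale m n (c : F) (psi : tensor R m n) : tensor R m n :=
  fun i j k => c * psi i j k.

Lemma slice_tscale m n c (psi : tensor R m n) i : slice (tscale c psi) i = c *: slice psi i.
Proof. by apply/matrixP=> j k; rewrite !mxE. Qed.

Lemma act_scale m n a b c A B C (psi : tensor R m n) :
  act (a *: A) (b *: B) (c *: C) psi = tscale (a * b * c) (act A B C psi).
Proof.
apply: slice_inj => i; rewrite slice_tscale !slice_act scaler_sumr.
apply: eq_bigr => x _; rewrite mxE linearZ /= -!scalemxAl -!scalemxAr !scalerA.
by congr (_ *: _); ring.
Qed.

Lemma act_tscale m n c A B C (psi : tensor R m n) :
  act A B C (tscale c psi) = tscale c (act A B C psi).
Proof.
apply: slice_inj => i; rewrite slice_tscale !slice_act scaler_sumr.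
apply: eq_bigr => x _; rewrite slice_tscale -scalemxAr -scalemxAl !scalerA.
by rewrite mulrC.
Qed.

End Canonical.
Arguments diag_tensor : clear implicits.

(** * Discriminants of binary quadratic and cubic determinant forms *)

Section PencilDeterminant.
Variable F : numFieldType.

Lemma pencil_det2 (x y : F) (X0 X1 : 'M[F]_2) : let f a b := \det (a *: X0 + b *: X1) in
  f x y = x ^+ 2 * f 1 0 + x * y * (f 1 1 - f 1 0 - f 0 1) + y ^+ 2 * f 0 1.
Proof. by rewrite /= !det2 !mxE; ring. Qed.

Lemma det3 (M : 'M[F]_3) (e := fun i j => M i j) : \det M =
  e ord30 ord30 * (e ord31 ord31 * e ord32 ord32 - e ord31 ord32 * e ord32 ord31)
  - e ord30 ord31 * (e ord31 ord30 * e ord32 ord32 - e ord31 ord32 * e ord32 ord30)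
  + e ord30 ord32 * (e ord31 ord30 * e ord32 ord31 - e ord31 ord31 * e ord32 ord30).
Proof.
rewrite (expand_det_row _ ord30) !big_ord_recl big_ord0 addr0 /cofactor !det2 !mxE /e.
rewrite /= !expr0 expr1 mul1r.
have -> : lift ord0 ord0 = ord31 by apply: val_inj.
have -> : lift ord0 (lift ord0 ord0) = ord32 by apply: val_inj.
have -> : ord0 = ord30 by apply: val_inj.
have e0 : lift ord30 (0 : 'I_2) = ord31 by apply: val_inj.
have e1 : lift ord30 (1 : 'I_2) = ord32 by apply: val_inj.
have e2 : lift ord31 (0 : 'I_2) = ord30 by apply: val_inj.
have e3 : lift ord31 (1 : 'I_2) = ord32 by apply: val_inj.
have e4 : lift ord32 (0 : 'I_2) = ord30 by apply: val_inj.
have e5 : lift ord32 (1 : 'I_2) = ord31 by apply: val_inj.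
rewrite e0 e1 e2 e3 e4 e5 /bump /=; ring.
Qed.


Lemma pencil_det3 (x y : F) (X0 X1 : 'M[F]_3) : let f a b := \det (a *: X0 + b *: X1) in
  f x y = x ^+ 3 * f 1 0 + x ^+ 2 * y * ((f 1 1 - f 1 (-1)) * 2^-1 - f 0 1)
    + x * y ^+ 2 * ((f 1 1 + f 1 (-1)) * 2^-1 - f 1 0) + y ^+ 3 * f 0 1.
Proof. by rewrite /= !det3 !mxE; field. Qed.

(* The discriminants of a binary quadratic and of a binary cubic form are
   expressed through the values of the form at (1,0), (0,1), (1,1) and (1,-1),
   from which its middle coefficients are recovered. *)
Definition quad_disc (a c p : F) := (p - a - c) * (p - a - c) - 4 * (a * c).

Definition cubic_disc (a d p q : F) :=
  let b := (p - q) * 2^-1 - d in let c := (p + q) * 2^-1 - a in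
  b * b * c * c - 4 * (a * c * c * c) - 4 * (b * b * b * d) - 27 * (a * a * d * d)
  + 18 * (a * b * c * d).

Lemma quad_disc_subst (f : F -> F -> F) x y z t :
  (forall x y, f x y = x ^+ 2 * f 1 0 + x * y * (f 1 1 - f 1 0 - f 0 1) + y ^+ 2 * f 0 1) ->
  quad_disc (f x y) (f z t) (f (x + z) (y + t))
  = (x * t - y * z) ^+ 2 * quad_disc (f 1 0) (f 0 1) (f 1 1).
Proof.
move=> h; rewrite (h x) (h z) (h (x + z)) /quad_disc; by ring.
Qed.

Lemma cubic_disc_subst (f : F -> F -> F) x y z t :
  (forall x y, f x y = x ^+ 3 * f 1 0 + x ^+ 2 * y * ((f 1 1 - f 1 (-1)) * 2^-1 - f 0 1)
    + x * y ^+ 2 * ((f 1 1 + f 1 (-1)) * 2^-1 - f 1 0) + y ^+ 3 * f 0 1) ->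
  cubic_disc (f x y) (f z t) (f (x + z) (y + t)) (f (x - z) (y - t))
  = (x * t - y * z) ^+ 6 * cubic_disc (f 1 0) (f 0 1) (f 1 1) (f 1 (-1)).
Proof.
move=> h; rewrite (h x) (h z) (h (x + z)) (h (x - z)) /cubic_disc.
set b := (f 1 1 - _) * _ - _; set c := (f 1 1 + _) * _ - _.
move: (f 1 0) (f 0 1) b c => a d b c; by field.
Qed.

Lemma comb10 (x y : F) : 1 * x + 0 * y = x. Proof. by ring. Qed.
Lemma comb01 (x y : F) : 0 * x + 1 * y = y. Proof. by ring. Qed.
Lemma comb11 (x y : F) : 1 * x + 1 * y = x + y. Proof. by ring. Qed.
Lemma comb1N1 (x y : F) : 1 * x + (-1) * y = x - y. Proof. by ring. Qed.

Lemma quad_discZ k a c p : quad_disc (k * a) (k * c) (k * p) = k ^+ 2 * quad_disc a c p.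
Proof. rewrite /quad_disc; by ring. Qed.

Lemma cubic_discZ k a d p q :
  cubic_disc (k * a) (k * d) (k * p) (k * q) = k ^+ 4 * cubic_disc a d p q.
Proof. rewrite /cubic_disc; by ring. Qed.

End PencilDeterminant.

Section Discriminant.
Variable R : realType.
Local Notation F := R[i].

Definition pdet n (x y : F) (psi : tensor R n n) : F :=
  \det (x *: slice psi 0 + y *: slice psi 1).

Lemma pdet_act n x y (psi : tensor R n n) A B C : \det B = 1 -> \det C = 1 ->
  pdet x y (act A B C psi) = pdet (x * A 0 0 + y * A 1 0) (x * A 0 1 + y * A 1 1) psi.
Proof.
move=> dB dC; rewrite /pdet !slice_act_mix pencil_comb.
rewrite conj_comb !det_mulmx dB det_tr dC.
by rewrite mul1r mulr1.
Qed.

Lemma pdet_tscale n x y c (psi : tensor R n n) :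
  pdet x y (tscale c psi) = c ^+ n * pdet x y psi.
Proof. by rewrite /pdet !slice_tscale !scalerA ![_ * c]mulrC -!scalerA -scalerDr detZ. Qed.

Lemma cont_pdet n x y : cont (@pdet n x y).
Proof. by apply: cont_det; apply: cont_mxD; apply: cont_mxZ; apply: cont_slice. Qed.

Lemma contN m n (f : tensor R m n -> F) : cont f -> cont (fun psi => - f psi).
Proof.
move=> cf; under eq_fun do rewrite -mulN1r.
by apply: contM => //; apply: cont_const.
Qed.


Definition disc2 (psi : tensor R 2 2) : F :=
  quad_disc (pdet 1 0 psi) (pdet 0 1 psi) (pdet 1 1 psi).

Definition disc3 (psi : tensor R 3 3) : F :=
  cubic_disc (pdet 1 0 psi) (pdet 0 1 psi) (pdet 1 1 psi) (pdet 1 (-1) psi).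

Lemma disc2_act A B C (psi : tensor R 2 2) : inG A B C -> disc2 (act A B C psi) = disc2 psi.
Proof.
move=> [dA [dB dC]].
rewrite /disc2 !(pdet_act _ _ _ _ dB dC).
rewrite !(comb10 (A 0 _) (A 1 _)) !(comb01 (A 0 _) (A 1 _)) !(comb11 (A 0 _) (A 1 _)).
rewrite (@quad_disc_subst _ (fun x y => pdet x y psi)) => [|x y]; last exact: pencil_det2.
by rewrite -det2 dA expr1n mul1r.
Qed.

Lemma disc3_act A B C (psi : tensor R 3 3) : inG A B C -> disc3 (act A B C psi) = disc3 psi.
Proof.
move=> [dA [dB dC]].
rewrite /disc3 !(pdet_act _ _ _ _ dB dC).
rewrite !(comb10 (A 0 _) (A 1 _)) !(comb01 (A 0 _) (A 1 _)) !(comb11 (A 0 _) (A 1 _)).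
rewrite !(comb1N1 (A 0 _) (A 1 _)).
rewrite (@cubic_disc_subst _ (fun x y => pdet x y psi)) => [|x y]; last exact: pencil_det3.
by rewrite -det2 dA expr1n mul1r.
Qed.

Lemma cont_quad_disc m n (a c p : tensor R m n -> F) : cont a -> cont c -> cont p ->
  cont (fun psi => quad_disc (a psi) (c psi) (p psi)).
Proof.
move=> ca cc cp.
have cb : cont (fun psi => p psi - a psi - c psi).
  exact: (contD (contD cp (contN ca)) (contN cc)).
exact: (contD (contM cb cb) (contN (contM (cont_const 4) (contM ca cc)))).
Qed.

Lemma cont_cubic_disc m n (a d p q : tensor R m n -> F) :
  cont a -> cont d -> cont p -> cont q ->
  cont (fun psi => cubic_disc (a psi) (d psi) (p psi) (q psi)).
Proof.
move=> ca cd cp cq.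
have cb : cont (fun psi => (p psi - q psi) * 2^-1 - d psi).
  exact: (contD (contM (contD cp (contN cq)) (cont_const 2^-1)) (contN cd)).
have cc : cont (fun psi => (p psi + q psi) * 2^-1 - a psi).
  exact: (contD (contM (contD cp cq) (cont_const 2^-1)) (contN ca)).
have mul4 f g h k : cont f -> cont g -> cont h -> cont k ->
    cont (fun psi : tensor R m n => f psi * g psi * h psi * k psi).
  by move=> cf cg ch ck; exact: (contM (contM (contM cf cg) ch) ck).
exact: (contD (contD (contD (contD (mul4 _ _ _ _ cb cb cc cc)
  (contN (contM (cont_const 4) (mul4 _ _ _ _ ca cc cc cc))))
  (contN (contM (cont_const 4) (mul4 _ _ _ _ cb cb cb cd))))
  (contN (contM (cont_const 27) (mul4 _ _ _ _ ca ca cd cd))))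
  (contM (cont_const 18) (mul4 _ _ _ _ ca cb cc cd))).
Qed.

Lemma cont_disc2 : cont disc2.
Proof. exact: (cont_quad_disc (cont_pdet 1 0) (cont_pdet 0 1) (cont_pdet 1 1)). Qed.

Lemma cont_disc3 : cont disc3.
Proof.
exact: (cont_cubic_disc (cont_pdet 1 0) (cont_pdet 0 1) (cont_pdet 1 1) (cont_pdet 1 (-1))).
Qed.

Lemma disc2_tscale c psi : disc2 (tscale c psi) = c ^+ 4 * disc2 psi.
Proof. by rewrite /disc2 !pdet_tscale quad_discZ -exprM. Qed.

Lemma disc3_tscale c psi : disc3 (tscale c psi) = c ^+ 12 * disc3 psi.
Proof. by rewrite /disc3 !pdet_tscale cubic_discZ -exprM. Qed.

End Discriminant.

Section SmallSquare.
Variable R : realType.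
Local Notation F := R[i].

Lemma pdet_canon2 (x y : F) : pdet x y (diag_tensor R 2) = x * y.
Proof.
rewrite /pdet !slice_canon2 det2 !mxE /= ?mulr0n ?mulr1n.
by rewrite !mulr0 !mulr1 !addr0 add0r mulr0 subr0.
Qed.

Lemma pdet_canon3 (x y : F) : pdet x y (diag_tensor R 3) = x * y * (x + y).
Proof.
rewrite /pdet !slice_canon3 -!linearZ -linearD /= det_diag !big_ord_recl big_ord0 !mxE /=.
by rewrite !(mulr0, mulr1, addr0, add0r) mulrA.
Qed.

Lemma disc2_canon : disc2 (diag_tensor R 2) = 1.
Proof.
by rewrite /disc2 !pdet_canon2 /quad_disc !(mulr0, mul0r, mulr1, subr0).
Qed.

Lemma disc3_canon : disc3 (diag_tensor R 3) = 1.
Proof.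
rewrite /disc3 !pdet_canon3 /cubic_disc !(mulr0, mul0r, mulr1, mul1r, subr0, subrr, addr0).
by rewrite -mulr2n mulfV ?pnatr_eq0 // !mulr1.
Qed.

Lemma act_perm m n (s : 'S_2) (t : 'S_m) (r : 'S_n) (psi : tensor R m n) i j k :
  act (perm_mx s) (perm_mx t) (perm_mx r) psi i j k = psi (s i) (t j) (r k).
Proof.
rewrite /act (bigD1 (s i)) //= [X in _ + X]big1 ?addr0 => [|i' ne]; last first.
  by do 2!(apply: big1 => ? _); rewrite !mxE eq_sym (negPf ne) !mul0r.
rewrite (bigD1 (t j)) //= [X in _ + X]big1 ?addr0 => [|j' ne]; last first.
  by apply: big1 => ? _; rewrite !mxE [t j == _]eq_sym (negPf ne) mulr0 !mul0r.
rewrite (bigD1 (r k)) //= [X in _ + X]big1 ?addr0 => [|k' ne]; last first.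
  by rewrite !mxE [r k == _]eq_sym (negPf ne) mulr0 !mul0r.
by rewrite !mxE !eqxx !mul1r.
Qed.

Let swap2 : 'M[F]_2 := perm_mx (tperm 0 1).
Let swap3 : 'M[F]_3 := perm_mx (tperm ord30 ord31).

Lemma det_swap2 : \det swap2 = -1.
Proof. by rewrite det_perm odd_tperm expr1. Qed.

Lemma det_swap3 : \det swap3 = -1.
Proof. by rewrite det_perm odd_tperm expr1. Qed.

Lemma canon2_swap : act swap2 swap2 swap2 (diag_tensor R 2) = diag_tensor R 2.
Proof.
apply/funext=> i; apply/funext=> j; apply/funext=> k; rewrite act_perm !permE.
by case: (ord2P i) => ->; case: (ord2P j) => ->; case: (ord2P k) => ->.
Qed.

Lemma canon3_swap : act swap2 swap3 swap3 (diag_tensor R 3) = diag_tensor R 3.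
Proof.
apply/funext=> i; apply/funext=> j; apply/funext=> k; rewrite act_perm !permE.
by case: (ord2P i) => ->; elim/ord3P: j; elim/ord3P: k.
Qed.

Lemma tscale_act m n (z : F) (psi : tensor R m n) :
  act (z *: 1%:M) 1%:M 1%:M psi = tscale z psi.
Proof. by have := act_scale z 1 1 1%:M 1%:M 1%:M psi; rewrite !scale1r !mulr1 act1. Qed.

Lemma sqr_pm1 (z : F) : z ^+ 4 = 1 -> z ^+ 2 = 1 \/ z ^+ 2 = -1.
Proof.
move=> z4; have /eqP : (z ^+ 2 - 1) * (z ^+ 2 + 1) = 0.
  by rewrite -subr_sqr -exprM z4 expr1n subrr.
by rewrite mulf_eq0 subr_eq0 addr_eq0 => /orP[] /eqP; [left|right].
Qed.

Lemma canon2_root (z : F) : z ^+ 4 = 1 ->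
  Defs.in_orbit (diag_tensor R 2) (tscale z (diag_tensor R 2)).
Proof.
move=> /sqr_pm1[z2|z2].
  exists (z *: 1%:M), 1%:M, 1%:M; split; last exact: tscale_act.
  by rewrite /inG detZ !det1 mulr1.
(* The swap fixes the tensor but has determinant -1, which [z ^+ 2 = -1] compensates; the scalars
   multiply to [z * z * (- z) = z]. *)
exists (z *: swap2), (z *: swap2), ((- z) *: swap2); split.
  by rewrite /inG !detZ det_swap2 sqrrN z2 mulrNN mulr1.
by rewrite act_scale canon2_swap mulrN -!expr2 z2 mulN1r opprK.
Qed.

Lemma canon3_root (z : F) : z ^+ 12 = 1 ->
  Defs.in_orbit (diag_tensor R 3) (tscale z (diag_tensor R 3)).
Proof.
move=> z12.
(* Since [z = z ^+ 9 * z ^+ 4], a fourth and a cube root of unity can be treated apart; the cube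
   root is a scalar matrix in SL_3. *)
have h4 : (z ^+ 9) ^+ 4 = 1 by rewrite -exprM (exprM z 12 3) z12 expr1n.
have w3 : (z ^+ 4) ^+ 3 = 1 by rewrite -exprM.
have [A [B [C [[dA [dB dC]] e]]]] : Defs.in_orbit (diag_tensor R 3) (tscale (z ^+ 9) (diag_tensor R 3)).
  move: (z ^+ 9) h4 => s /sqr_pm1[s2|s2].
    exists (s *: 1%:M), 1%:M, 1%:M; split; last exact: tscale_act.
    by rewrite /inG detZ !det1 mulr1.
  exists (s *: swap2), ((-1) *: swap3), ((-1) *: swap3); split.
    rewrite /inG !detZ det_swap2 det_swap3 s2 mulrNN mulr1; split=> //.
    by rewrite -exprSr -signr_odd.
  by rewrite act_scale canon3_swap mulrN1 mulrN1 opprK.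
exists A, (z ^+ 4 *: B), C; split; first by rewrite /inG detZ w3 mul1r.
have := act_scale 1 (z ^+ 4) 1 A B C (diag_tensor R 3); rewrite !scale1r mul1r mulr1 e => ->.
apply: slice_inj => i; rewrite !slice_tscale scalerA -exprD.
by rewrite (exprD z 12 1) z12 mul1r.
Qed.

Lemma inG_inv m n A B C : @inG R m n A B C -> inG (invmx A) (invmx B) (invmx C).
Proof. by move=> [a [b c]]; rewrite /inG !det_inv a b c !invr1. Qed.

Lemma actK m n A B C (psi phi : tensor R m n) : inG A B C ->
  act A B C psi = phi -> act (invmx A) (invmx B) (invmx C) phi = psi.
Proof.
move=> [a [b c]] <-; rewrite actM !mulVmx ?act1 // unitmxE ?a ?b ?c unitr1 //.
Qed.

Lemma in_orbit_trans m n (psi phi chi : tensor R m n) :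
  Defs.in_orbit psi phi -> Defs.in_orbit phi chi -> Defs.in_orbit psi chi.
Proof.
move=> [A [B [C [g <-]]]] [A' [B' [C' [g' <-]]]].
by exists (A' *m A), (B' *m B), (C' *m C); split; [apply: inGM|rewrite actM].
Qed.

Lemma in_orbit_sym m n (psi phi : tensor R m n) :
  Defs.in_orbit psi phi -> Defs.in_orbit phi psi.
Proof.
move=> [A [B [C [g e]]]]; exists (invmx A), (invmx B), (invmx C).
by split; [apply: inG_inv|apply: actK e].
Qed.

Lemma in_orbit_tscale m n c (psi phi : tensor R m n) :
  Defs.in_orbit psi phi -> Defs.in_orbit (tscale c psi) (tscale c phi).
Proof. by move=> [A [B [C [g <-]]]]; exists A, B, C; rewrite act_tscale. Qed.

Lemma regular_scaled_orbit n (psi : tensor R n n) : (2 <= n <= 3)%N -> semistable psi ->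
  exists2 c : F, c != 0 & Defs.in_orbit (tscale c (diag_tensor R n)) psi.
Proof.
move=> hn ss.
have [A [B [C [uA uB uC ->]]]] := canon_regular hn (semistable_regular hn ss).
case: n psi hn ss B C uB uC => // n psi hn ss B C uB uC.
have [a [A1 [a0 dA ->]]] := unit_scale uA.
have [b [B1 [b0 dB ->]]] := unit_scale uB.
have [c [C1 [c0 dC ->]]] := unit_scale uC.
exists (a * b * c); first by rewrite !mulf_neq0.
by exists A1, B1, C1; rewrite act_scale act_tscale.
Qed.

Lemma small_closed_of_invariant n N (f : tensor R n n -> F) (psi phi : tensor R n n) :
  (2 <= n <= 3)%N -> cont f ->
  (forall A B C chi, inG A B C -> f (act A B C chi) = f chi) ->
  (forall c chi, f (tscale c chi) = c ^+ N * f chi) -> f (diag_tensor R n) = 1 ->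
  (forall z, z ^+ N = 1 -> Defs.in_orbit (diag_tensor R n) (tscale z (diag_tensor R n))) ->
  semistable psi -> in_orbit_closure psi phi -> Defs.in_orbit psi phi.
Proof.
move=> hn cf invf homf f1 root ss cl.
have ss' : semistable phi by move=> h; apply: ss; apply: nullcone_closure cl h.
have [c c0 oc] := regular_scaled_orbit hn ss.
have [d d0 od] := regular_scaled_orbit hn ss'.
have orb e chi : Defs.in_orbit (tscale e (diag_tensor R n)) chi -> f chi = e ^+ N.
  by move=> [A [B [C [g <-]]]]; rewrite invf // homf f1 mulr1.
have e : d ^+ N = c ^+ N.
  rewrite -(orb _ _ oc) -(orb _ _ od); apply: (invariant_closure cf _ cl) => *.
  exact: invf.
have z1 : (d / c) ^+ N = 1 by rewrite expr_div_n e mulfV // expf_neq0.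
apply: in_orbit_trans (in_orbit_sym oc) _; apply: in_orbit_trans od.
have := in_orbit_tscale c (root _ z1).
have -> // : tscale c (tscale (d / c) (diag_tensor R n)) = tscale d (diag_tensor R n).
by apply: slice_inj => i; rewrite !slice_tscale scalerA mulrC mulfVK.
Qed.

Lemma small_closed n (psi phi : tensor R n n) : (2 <= n <= 3)%N ->
  semistable psi -> in_orbit_closure psi phi -> Defs.in_orbit psi phi.
Proof.
move=> hn; have [en|en] : n = 2 \/ n = 3 by lia.
  subst n; apply: (small_closed_of_invariant hn (@cont_disc2 R)).
  - by move=> *; apply: disc2_act.
  - exact: disc2_tscale.
  - exact: disc2_canon.
  exact: canon2_root.
subst n; apply: (small_closed_of_invariant hn (@cont_disc3 R)).
- by move=> *; apply: disc3_act.
- exact: disc3_tscale.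
- exact: disc3_canon.
exact: canon3_root.
Qed.

End SmallSquare.

(** * A strictly semistable pencil for m = n >= 4 *)

Section Magnitude.
Variable R : realType.
Implicit Types z w : R[i].

(** The norm of [R[i]] takes values in [R[i]]; its real part lives in the ordered field [R], where
    [lra] and [nra] work. *)
Definition mag z : R := complex.Re `|z|.

Lemma magE z : `|z| = ((mag z)%:C)%C.
Proof. by rewrite /mag normc_def. Qed.

Lemma mag_ge0 z : 0 <= mag z.
Proof. by rewrite -(lecR 0) -magE normr_ge0. Qed.

Lemma magM z w : mag (z * w) = mag z * mag w.
Proof. by apply: complexI; rewrite rmorphM /= -!magE normrM. Qed.

Lemma mag1 : mag 1 = 1.
Proof. by apply: complexI; rewrite -magE normr1. Qed.

Lemma magX z k : mag (z ^+ k) = mag z ^+ k.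
Proof. by apply: complexI; rewrite rmorphXn /= -!magE normrX. Qed.

Lemma magN z : mag (- z) = mag z.
Proof. by apply: complexI; rewrite -!magE normrN. Qed.

Lemma magD z w : mag (z + w) <= mag z + mag w.
Proof. by rewrite -lecR rmorphD /= -!magE ler_normD. Qed.

Lemma magMn z k : mag (z *+ k) = mag z *+ k.
Proof. by apply: complexI; rewrite rmorphMn /= -!magE normrMn. Qed.

Definition lin_at (L v : R[i] * R[i]) : R[i] := L.1 * v.1 + L.2 * v.2.
Definition lin_norm (L : R[i] * R[i]) : R := mag L.1 + mag L.2.
Definition small_at L v : bool := mag (lin_at L v) < lin_norm L / 3.

Definition test_point (q : nat) : R[i] * R[i] :=
  nth (1, -1) [:: (1, 0); (0, 1); (1, 1)] q.

(** Two test points determine a linear form, so both values cannot be small against its norm. The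
    threshold 1/3 is sharp: [x - 2 y] has norm 3 and values of modulus 1 at (1,0) and (1,1). *)
Lemma small_at_uniq L q q' : (q < q' < 4)%N ->
  small_at L (test_point q) -> small_at L (test_point q') -> False.
Proof.
case: L => a b; rewrite /small_at /lin_norm /lin_at /=.
have h1 : mag b <= mag (a + b) + mag a.
  by rewrite -(magN a) (le_trans _ (magD _ _)) // addrAC subrr add0r.
have h2 : mag b <= mag (a - b) + mag a.
  rewrite -(magN (a - b)) (le_trans _ (magD _ _)) //.
  by rewrite opprB subrK.
have h3 : mag a <= mag (a + b) + mag b.
  by rewrite -(magN b) (le_trans _ (magD _ _)) // addrK.
have h4 : mag a <= mag (a - b) + mag b.
  by rewrite (le_trans _ (magD _ _)) // subrK.
have h5 : mag a *+ 2 <= mag (a + b) + mag (a - b).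
  rewrite -magMn (le_trans _ (magD _ _)) //.
  by rewrite addrACA subrr addr0.
have h5' : mag b *+ 2 <= mag (a + b) + mag (a - b).
  rewrite -magMn -(magN (a - b)) (le_trans _ (magD _ _)) //.
  by rewrite opprB addrC addrA subrK.
have h6 := mag_ge0 a; have h7 := mag_ge0 b.
case: q => [|[|[|[|q]]]]; case: q' => [|[|[|[|q']]]] //= hq;
  rewrite ?mulr0 ?mulr1 ?addr0 ?add0r ?mulrN1 => s1 s2; first [lra | move: hq; lia].
Qed.

(* A form is small at no more than one of the four test points, so one of them
   is good for all three forms. *)
Lemma good_point L1 L2 L3 : exists2 q, (q < 4)%N &
  [/\ lin_norm L1 / 3 <= mag (lin_at L1 (test_point q)),
      lin_norm L2 / 3 <= mag (lin_at L2 (test_point q)) &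
      lin_norm L3 / 3 <= mag (lin_at L3 (test_point q))].
Proof.
pose bad q := [|| small_at L1 (test_point q), small_at L2 (test_point q) |
  small_at L3 (test_point q)].
suff [q q4] : exists2 q, (q < 4)%N & ~~ bad q.
  by rewrite !negb_or -!leNgt => /and3P[? ? ?]; exists q.
have [|h0] := boolP (bad 0%N); last by exists 0%N.
have [|h1] := boolP (bad 1%N); last by exists 1%N.
have [|h2] := boolP (bad 2%N); last by exists 2%N.
have [|h3] := boolP (bad 3%N); last by exists 3%N.
have u1 := @small_at_uniq L1; have u2 := @small_at_uniq L2; have u3 := @small_at_uniq L3.
case/or3P=> ? /or3P[] ? /or3P[] ? /or3P[] ?; exfalso;
  first [ by apply: (@u1 0%N 1%N) | by apply: (@u1 0%N 2%N) | by apply: (@u1 0%N 3%N)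
        | by apply: (@u1 1%N 2%N) | by apply: (@u1 1%N 3%N) | by apply: (@u1 2%N 3%N)
        | by apply: (@u2 0%N 1%N) | by apply: (@u2 0%N 2%N) | by apply: (@u2 0%N 3%N)
        | by apply: (@u2 1%N 2%N) | by apply: (@u2 1%N 3%N) | by apply: (@u2 2%N 3%N)
        | by apply: (@u3 0%N 1%N) | by apply: (@u3 0%N 2%N) | by apply: (@u3 0%N 3%N)
        | by apply: (@u3 1%N 2%N) | by apply: (@u3 1%N 3%N) | by apply: (@u3 2%N 3%N) ].
Qed.

Lemma wedge_le (a b c d : R[i]) :
  mag (a * d - b * c) <= lin_norm (a, b) * lin_norm (c, d).
Proof.
rewrite (le_trans (magD _ _)) // magN !magM /lin_norm /=.
have := mag_ge0 a; have := mag_ge0 b; have := mag_ge0 c; have := mag_ge0 d.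
nra.
Qed.

(** The three forms have pairwise determinants 1, so any two of their norms have product at least 1;
    multiplying the three inequalities handles [e = 1]. A good test point then loses at most a
    factor 3 per linear factor. The bound depends only on [k] and [e], which makes it a quantitative
    semistability of [x^k y^k (x + y)^e]. *)
Lemma form_product_large (a b c d : R[i]) k e : a * d - b * c = 1 -> (e <= 1)%N -> (e <= k)%N ->
  exists2 q, (q < 4)%N & let v := test_point q in
    (3^-1) ^+ (k + k + e) <= mag (lin_at (a, b) v ^+ k * lin_at (c, d) v ^+ k
      * lin_at (a + c, b + d) v ^+ e).
Proof.
move=> w12 e1 ek; pose N1 := lin_norm (a, b); pose N2 := lin_norm (c, d).
pose N3 := lin_norm (a + c, b + d).
have h12 : 1 <= N1 * N2 by rewrite -mag1 -w12 wedge_le.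
have h13 : 1 <= N1 * N3.
  by rewrite -mag1 -w12 (_ : _ - _ = a * (b + d) - b * (a + c)) ?wedge_le //; ring.
have h32 : 1 <= N3 * N2.
  by rewrite -mag1 -w12 (_ : _ - _ = (a + c) * d - (b + d) * c) ?wedge_le //; ring.
have p1 : 0 <= N1 by rewrite addr_ge0 ?mag_ge0.
have p2 : 0 <= N2 by rewrite addr_ge0 ?mag_ge0.
have p3 : 0 <= N3 by rewrite addr_ge0 ?mag_ge0.
have hN : 1 <= N1 ^+ k * N2 ^+ k * N3 ^+ e.
  rewrite -exprMn.
  case: e e1 ek => [|[|//]] _ ek; first by rewrite mulr1 exprn_ege1.
  case: k ek => // k _; rewrite exprSr -mulrA expr1.
  rewrite -[1]mulr1 ler_pM //; first by rewrite exprn_ege1.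
  rewrite leNgt; apply/negP => lt1.
  have : 1 <= (N1 * N2) * ((N1 * N3) * (N3 * N2)).
    rewrite -[1]mulr1 ler_pM //; rewrite -[1]mulr1 ler_pM //.
  have -> : (N1 * N2) * ((N1 * N3) * (N3 * N2)) = (N1 * N2 * N3) ^+ 2 by ring.
  by rewrite leNgt exprn_ilt1 // !mulr_ge0.
have [q q4 [g1 g2 g3]] := good_point (a, b) (c, d) (a + c, b + d).
exists q => //=; rewrite !magM !magX.
have -> : 3^-1 ^+ (k + k + e) = 3^-1 ^+ k * 3^-1 ^+ k * 3^-1 ^+ e :> R by rewrite !exprD.
have t0 : 0 <= 3^-1 :> R by rewrite invr_ge0.
apply: (@le_trans _ _ ((N1 / 3) ^+ k * (N2 / 3) ^+ k * (N3 / 3) ^+ e)).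
  rewrite !exprMn.
  have -> : N1 ^+ k * 3^-1 ^+ k * (N2 ^+ k * 3^-1 ^+ k) * (N3 ^+ e * 3^-1 ^+ e)
    = (N1 ^+ k * N2 ^+ k * N3 ^+ e) * (3^-1 ^+ k * 3^-1 ^+ k * 3^-1 ^+ e).
    by move: (3^-1 ^+ k) (3^-1 ^+ e) => x y; ring.
  by rewrite ler_peMl // !mulr_ge0 // exprn_ge0.
by apply: ler_pM; rewrite ?mulr_ge0 ?exprn_ge0 ?divr_ge0 //;
  [apply: ler_pM|]; rewrite ?exprn_ge0 ?divr_ge0 // lerXn2r ?nnegrE ?divr_ge0 ?mag_ge0.
Qed.

End Magnitude.

(** * The bidiagonal witness and its degeneration *)

Section Witness.
Variables (R : realType) (n : nat).
Local Notation F := R[i].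
Hypothesis n4 : (4 <= n)%N.

(* The diagonal forms are [x], then [n./2] times [y], then [x + y] if [n] is
   odd, then [x] again up to a total of [n./2] times. *)
Definition diag_form (j : nat) (x y : F) : F :=
  if j == 0%N then x
  else if (j < (n./2).+1)%N then y
  else if (j < (n./2).+1 + odd n)%N then x + y
  else x.

(* With [keep = predT] the pencil is [diag + (x - y) * superdiagonal]. *)
Definition bidiagonal (keep : pred nat) : tensor R n n := fun i j k =>
  if j == k then diag_form j (i == 0)%:R (i == 1)%:R
  else if (k == j.+1 :> nat) && keep j then (i == 0)%:R - (i == 1)%:R else 0.

Lemma diag_form_comb j (x y : F) :
  x * diag_form j 1 0 + y * diag_form j 0 1 = diag_form j x y.
Proof.
rewrite /diag_form; case: ifP => _; first by rewrite mulr1 mulr0 addr0.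
case: ifP => _; first by rewrite mulr1 mulr0 add0r.
by case: ifP => _; rewrite ?addr0 ?add0r ?mulr1 ?mulr0 ?addr0.
Qed.

Lemma bidiagonal_pencil keep x y j k :
  (x *: slice (bidiagonal keep) 0 + y *: slice (bidiagonal keep) 1) j k =
  if j == k then diag_form j x y
  else if (k == j.+1 :> nat) && keep j then x - y else 0.
Proof.
rewrite !mxE /bidiagonal /=; case: eqP => _; first exact: diag_form_comb.
by case: ifP => _; rewrite ?subr0 ?sub0r ?mulr1 ?mulrN1 ?mulr0 ?addr0.
Qed.

Lemma pdet_bidiagonal keep x y :
  pdet x y (bidiagonal keep) = \prod_(j < n) diag_form j x y.
Proof.
rewrite /pdet -det_tr det_trig; last first.
  apply/is_trig_mxP => i j ij; rewrite mxE bidiagonal_pencil.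
  have -> : (j == i) = false by apply/eqP=> e; rewrite e ltnn in ij.
  by have -> : (i == j.+1 :> nat) = false by lia.
by apply: eq_bigr => j _; rewrite mxE bidiagonal_pencil eqxx.
Qed.

Lemma prod_diag_form x y : \prod_(j < n) diag_form j x y
  = x ^+ n./2 * y ^+ n./2 * (x + y) ^+ odd n.
Proof.
have en : n = (odd n + n./2 + n./2)%N by have := odd_double_half n; lia.
have k1 : (1 < n./2)%N by lia.
have chunk a b c : (forall j, (a <= j < b)%N -> diag_form j x y = c) ->
    \prod_(a <= j < b) diag_form j x y = c ^+ (b - a).
  by move=> h; rewrite (eq_big_nat _ _ h) prodr_const_nat.
rewrite -(big_mkord predT (fun j => diag_form j x y)) /=.
rewrite (@big_cat_nat _ _ _ 1) //=; last by lia.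
rewrite (@big_cat_nat _ _ _ (n./2).+1 1) //=; last by lia.
rewrite (@big_cat_nat _ _ _ ((n./2).+1 + odd n) (n./2).+1) //=; try lia.
have c1 : diag_form 0 x y = x by [].
have c2 j : (1 <= j < (n./2).+1)%N -> diag_form j x y = y.
  by case/andP; rewrite lt0n /diag_form => /negPf-> ->.
have c3 j : ((n./2).+1 <= j < (n./2).+1 + odd n)%N -> diag_form j x y = x + y.
  case/andP=> h h'; rewrite /diag_form h' [(j < _.+1)%N]ltnNge h /=.
  by rewrite (negPf (lt0n_neq0 (leq_trans _ h))).
have c4 j : ((n./2).+1 + odd n <= j < n)%N -> diag_form j x y = x.
  case/andP=> h _; have h' := leq_trans (leq_addr _ _) h.
  rewrite /diag_form ![(j < _)%N]ltnNge h h' /=.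
  by rewrite (negPf (lt0n_neq0 (leq_trans _ h'))).
rewrite big_nat1 c1 (chunk _ _ _ c2) (chunk _ _ _ c3) (chunk _ _ _ c4).
rewrite subSS subn0 addKn.
have -> : (n - ((n./2).+1 + odd n) = (n./2).-1)%N by lia.
have -> : x ^+ n./2 = x * x ^+ (n./2).-1 by rewrite -exprS prednK //; lia.
by rewrite -!mulrA; congr (_ * _); rewrite [RHS]mulrC -mulrA.
Qed.

Definition witness := bidiagonal predT.

(** The determinant form is continuous in the tensor and [G] changes it only by an SL_2
    substitution. Near zero it would be tiny at all four test points, against the uniform bound of
    [form_product_large]. *)
Lemma witness_semistable : semistable witness.
Proof.
move=> /closureP h.
pose e0 : R := (3^-1) ^+ (n./2 + n./2 + odd n).
have e00 : 0 < (e0%:C)%C :> F by rewrite ltcR exprn_gt0 ?invr_gt0.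
pose f q (psi : tensor R n n) := pdet (test_point R q).1 (test_point R q).2 psi.
have cf q : cont (f q) by apply: cont_pdet.
have [d d0 hd] := cont_common (iota 0 4) (zero_tensor R n n) cf e00.
have [A [B [C [[dA [dB dC]] /hd /allP small]]]] := h d d0.
have w : A 0 0 * A 1 1 - A 1 0 * A 0 1 = 1 by rewrite -dA det2; ring.
have k1 : (1 < n./2)%N by lia.
have [q q4] := form_product_large w (leq_b1 (odd n)) (leq_trans (leq_b1 _) (ltnW k1)).
move=> /= big.
have := small q; rewrite mem_iota /= q4 => /(_ isT).
have z0 : f q (zero_tensor R n n) = 0.
  rewrite /f /pdet.
  have -> : forall x y : F, x *: slice (zero_tensor R n n) 0 + y *: slice (zero_tensor R n n) 1 = 0.
    by move=> x y; apply/matrixP=> i j; rewrite !mxE !mulr0 addr0.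
  by rewrite -(prednK (ltnW (ltnW (ltnW n4)))) det0.
rewrite z0 subr0 magE ltcR /f pdet_act // pdet_bidiagonal prod_diag_form.
rewrite ltNge => /negP; apply; apply: le_trans big _.
rewrite /lin_at /=; set v := test_point R q.
rewrite (mulrC v.1 (A 0 0)) (mulrC v.2 (A 1 0)) (mulrC v.1 (A 0 1)) (mulrC v.2 (A 1 1)).
by rewrite (_ : (A 0 0 + A 0 1) * v.1 + _ = A 0 0 * v.1 + A 1 0 * v.2 + (A 0 1 * v.1 + A 1 1 * v.2)) //; ring.
Qed.

Lemma diag_form_neq0 j (x : F) : x != 0 -> diag_form j x x != 0.
Proof.
move=> x0; have xx : x + x != 0 by rewrite -mulr2n mulrn_eq0.
by rewrite /diag_form; do 3!case: ifP => _ //.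
Qed.

(** For [x = y] the member is triangular with diagonal entries [x] or [2 x], hence invertible.
    Otherwise, deleting the last row and the first column leaves a triangular matrix with [x - y] on
    the diagonal. *)
Lemma witness_rank x y : (x != 0) || (y != 0) ->
  (n.-1 <= \rank (x *: slice witness 0 + y *: slice witness 1)%R)%N.
Proof.
move=> xy; set M := x *: _ + y *: _.
have hM i j : M i j = if i == j then diag_form i x y
    else if (j == i.+1 :> nat) && true then x - y else 0 by apply: bidiagonal_pencil.
have [exy|nxy] := eqVneq x y.
  have uM : M \in unitmx.
    have -> : M \in unitmx = (pdet x y witness \is a GRing.unit) by [].
    rewrite unitfE pdet_bidiagonal; apply/prodf_neq0 => j _; rewrite -exy.
    by apply: diag_form_neq0; move: xy; rewrite -exy orbb.
  by rewrite mxrank_unit // leq_pred.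
case: (n) n4 M hM => // p _ M hM /=.
pose N := row' ord_max (col' ord0 M).
have hN (i j : 'I_p) : N i j = if (i == j.+1 :> nat) then diag_form i x y
    else if (j == i :> nat) then x - y else 0.
  have e1 : lift ord_max i = i :> nat by apply: lift_max.
  have e2 : lift ord0 j = j.+1 :> nat by apply: lift0.
  by rewrite !mxE hM -val_eqE [val _]e1 [val _]e2 e1 e2 eqSS andbT.
have uN : N \in unitmx.
  rewrite unitmxE unitfE det_trig; last first.
    apply/is_trig_mxP => i j ij; rewrite hN.
    have -> : (i == j.+1 :> nat) = false by lia.
    by have -> : (j == i :> nat) = false by lia.
  apply/prodf_neq0 => i _; rewrite hN eqxx.
  have -> : (i == i.+1 :> nat) = false by lia.
  by rewrite subr_eq0.
have rN : (p <= \rank N)%N by rewrite (mxrank_unit uN).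
rewrite (leq_trans rN) // /N row'Esub (leq_trans (mxrankS (rowsub_sub _ _))) //.
by rewrite col'Esub -mxrank_tr -[in leqRHS]mxrank_tr trmx_mxsub mxrankS // rowsub_sub.
Qed.

(* Scaling the first and the last coordinates by [t] and [1/t] kills the two
   extreme superdiagonal entries. *)
Definition inner (j : nat) : bool := (j != 0%N) && (j.+1 != n.-1).

Lemma witness_degenerates : in_orbit_closure witness (bidiagonal inner).
Proof.
apply/closureP => e e0.
pose t := e / 2; have t0 : 0 < t by rewrite divr_gt0.
have te : t < e by rewrite ltr_pdivrMr // mulr_natr mulr2n ltrDl.
have tn : t != 0 by rewrite gt_eqF.
pose w (s : F) (j : 'I_n) := if j == 0 :> nat then s else if j == n.-1 :> nat then s^-1 else 1.
have dw s : s != 0 -> \det (diag_mx (\row_j w s j)) = 1.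
  move=> s0; rewrite det_diag.
  have hl : (n.-1 < n)%N by lia.
  rewrite (bigD1 (Ordinal (leq_trans (isT : (0 < 4)%N) n4))) //= (bigD1 (Ordinal hl)) //=; last first.
    by rewrite -val_eqE /=; lia.
  rewrite !mxE /w /= eqxx (_ : (n.-1 == 0)%N = false); last by lia.
  rewrite big1 ?mulr1 ?mulfV // => j; rewrite -!val_eqE /= mxE /w => /andP[/negPf-> /negPf->].
  by [].
exists (diag_mx (const_mx 1)), (diag_mx (\row_j w t j)), (diag_mx (\row_j w t^-1 j)).
split; first by rewrite /inG !dw ?invr_eq0 // diag_const_mx det1.
move=> x y z; rewrite act_diag !mxE mul1r /witness /bidiagonal andbT.
have wK j : w t j * w t^-1 j = 1.
  rewrite /w; case: ifP => _; first by rewrite mulfV.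
  by case: ifP => _; rewrite ?invrK ?mulVf ?mulr1.
have [<-|yz] := eqVneq y z; first by rewrite wK mul1r subrr normr0.
case: eqP => [ez|_] /=; last by rewrite mulr0 subrr normr0.
rewrite /inner /w ez /=.
have zn : (y.+1 < n)%N by rewrite -ez.
have -> : (y == n.-1 :> nat) = false by lia.
have s1 : `|(x == 0)%:R - (x == 1)%:R| = 1 :> F.
  by case: (ord2P x) => ->; rewrite /= ?subr0 ?sub0r ?normrN normr1.
have [y0|y0] := eqVneq (y : nat) 0%N.
  rewrite /= y0 (_ : (1 == n.-1)%N = false); last by lia.
  by rewrite mulr1 subr0 normrM s1 mulr1 gtr0_norm.
have [yl|yl] := eqVneq y.+1 n.-1; rewrite /= ?invrK.
  by rewrite mul1r subr0 normrM s1 mulr1 gtr0_norm.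
by rewrite !mul1r subrr normr0.
Qed.

Lemma witness_orbit : ~ Defs.in_orbit witness (bidiagonal inner).
Proof.
move=> [A [B [C [[dA [dB dC]] e]]]].
have n0 : (0 < n)%N by apply: leq_trans n4.
have nl : (n.-1 < n)%N by rewrite prednK.
(* [E] selects the first and the last row. Both have diagonal form [x], absent from slice 1; [inner]
   removes the superdiagonal entry of the first, and the last has none. So this slice has rank at
   most [n - 2]. *)
pose E : 'M[F]_(2, n) := \matrix_(i, j) (if i == 0 then j == 0 :> nat else j == n.-1 :> nat)%:R.
have fE : row_free E.
  apply/row_freeP.
  exists (\matrix_(j, i) (if i == 0 then j == 0 :> nat else j == n.-1 :> nat)%:R).
  apply/matrixP=> i i'; rewrite !mxE.
  rewrite (bigD1 (if i == 0 then Ordinal n0 else Ordinal nl)) //= big1 ?addr0.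
    have ln : (n.-1 == 0)%N = false by lia.
    by case: (ord2P i) => ->; case: (ord2P i') => ->; rewrite !mxE /= ?eqxx ?ln ?[(0 == _)%N]eq_sym ?ln ?mulr1 ?mulr0.
  move=> j; rewrite !mxE -val_eqE; case: (ord2P i) => -> /= /negPf->; by rewrite mul0r.
have EM : E *m slice (bidiagonal inner) 1 = 0.
  apply/matrixP=> i k; rewrite mxE [RHS]mxE.
  rewrite (bigD1 (if i == 0 then Ordinal n0 else Ordinal nl)) //= big1 ?addr0; last first.
    by move=> j; rewrite !mxE -val_eqE; case: (ord2P i) => -> /= /negPf->; rewrite mul0r.
  rewrite !mxE /bidiagonal /=.
  set j := (if i == 0 then Ordinal n0 else Ordinal nl).
  rewrite (_ : diag_form j _ _ = 0); last first.
    rewrite /j /diag_form; case: (ord2P i) => -> //=.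
    have -> : (n.-1 == 0)%N = false by lia.
    have -> : (n.-1 < (n./2).+1)%N = false by lia.
    by have -> : (n.-1 < (n./2).+1 + odd n)%N = false by have := odd_double_half n; lia.
  have -> : (k == j.+1 :> nat) && inner j = false.
    rewrite /j /inner; case: (ord2P i) => -> /=; first by rewrite andbF.
    by have := ltn_ord k; case: eqP => //; lia.
  by rewrite if_same mulr0.
have := mulmx0_rank_max EM.
rewrite (eqP fE) -e slice_act_mix mix_conj.
have uB : B \in unitmx by rewrite unitmxE dB unitr1.
have uC : C^T \in unitmx by rewrite unitmx_tr unitmxE dC unitr1.
rewrite mxrankMfree ?row_free_unit // eqmxMfull ?row_full_unit //.
have a0 : (A 1 0 != 0) || (A 1 1 != 0).
  rewrite -negb_and; apply/negP=> /andP[/eqP h0 /eqP h1].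
  by move/eqP: dA; rewrite det2 h0 h1 !mulr0 subr0 eq_sym oner_eq0.
move=> h; have := leq_trans (leq_add (leqnn 2) (witness_rank a0)) h; lia.
Qed.

End Witness.

Lemma zero_in_nullcone (R : realType) m n : in_nullcone (zero_tensor R m n).
Proof.
apply/closureP => e e0; exists 1%:M, 1%:M, 1%:M; split; first by rewrite /inG !det1.
by move=> x y z; rewrite act1 subrr normr0.
Qed.

Unset Implicit Arguments.

(* A state [psi] in P(H) is represented by a nonzero vector psi. *)
Theorem theorem3 (R : realType) (m n : nat) :
  (2 <= m)%N -> (m <= n)%N ->
  ((exists psi : tensor R m n, psi <> zero_tensor R m n /\ strictly_semistable psi)
   <-> (m = n /\ (4 <= m)%N)).
Proof.
move=> m2 mn; split.
  move=> [psi [_ [ss np]]].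
  move: mn; rewrite leq_eqVlt => /predU1P[emn|lmn]; last first.
    by case: np; split=> // phi; apply: wide_closed => //; apply: leq_trans m2.
  subst n; split=> //; rewrite leqNgt; apply/negP => m4; apply: np; split=> // phi.
  by apply: small_closed => //; rewrite m2.
move=> [emn m4]; subst n; exists (@witness R m).
have ss := @witness_semistable R m m4; split.
  by move=> e; apply: ss; rewrite e; apply: zero_in_nullcone.
split=> // -[_ /(_ _ (@witness_degenerates R m m4))].
exact: (witness_orbit m4).
Qed.
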